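(* The limit $\lim_{n\to\infty} n^{-2} f^{(3)}(n;6,4)$ exists and $$\lim_{n\to\infty} n^{-2} f^{(3)}(n;6,4)=\frac{7}{36}.$$
   Context: An $r$-graph is a finite $r$-uniform hypergraph (its edge set is a set of $r$-element subsets of its finite vertex set). For positive integers $r,s,k,n$, $f^{(r)}(n;s,k)$ denotes the maximum number of edges in an $r$-graph on $n$ vertices that contains no subgraph with exactly $k$ edges and at most $s$ vertices; equivalently, in which there are no $k$ distinct edges whose union has at most $s$ vertices. *)

(* Defs.v *)
From mathcomp Require Import all_boot.

Set Implicit Arguments.
Unset Strict Implicit.
Unset Printing Implicit Defensive.

Section Hypergraphs.
Variable V : finType.

(* A hypergraph on the vertex set V is identified with its set of edges. *)
Definition rgraph (r : nat) (E : {set {set V}}) : bool :=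
  [forall e in E, #|e| == r].

(* A subgraph with edge set F exists on at most s vertices iff the union of the
   edges of F, which is [cover F], has at most s elements. *)
Definition sk_free (s k : nat) (E : {set {set V}}) : bool :=
  [forall F : {set {set V}},
     (F \subset E) && (#|F| == k) ==> ~~ (#|cover F| <= s)].

End Hypergraphs.

(* For k > 0 the empty hypergraph is admissible, so this maximum is attained;
   the default value 0 of \max over an empty family plays no role. *)
Definition fmax (r n s k : nat) : nat :=
  \max_(E : {set {set 'I_n}} | rgraph r E && sk_free s k E) #|E|.

(* Main.v *)
Require Import Defs.
From mathcomp Require Import all_boot all_order all_algebra.
From mathcomp Require Import zify ring lra.

(* Upper bound.  At most n edges lie in a 4-set carrying three edges; discard them.  Call two
   of the remaining edges a diamond if they share a pair; the missing pair of a diamond is the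
   symmetric difference.  Distinct diamonds have distinct missing pairs.  If the missing pair
   is covered by an edge g, then the two edges of the diamond share pairs with no other edge,
   and g lies in no diamond and contains at most three missing pairs.  So at most 3|E|/7
   diamonds have a covered missing pair, and counting pairs gives 18 |E| <= 7 C(n,2).

   Lower bound.  The extremal pattern is a triangle with a diamond on each of its three sides:
   7 edges claiming 18 pairs.  Six more pairs of each copy are reserved: no copy may claim them.
   Copies that claim disjoint sets of pairs, claim no reserved pair and create no Pasch
   configuration form a (6,4)-free hypergraph.  The cyclic shifts of one copy decompose K_37.
   Blow up every vertex of K_37 to A x A with A = Z/m, and replace every copy by the lines
   i |-> (a + u_i b, a' + v_i b'), where u_i <> u_k and v_i <> v_k on claimed pairs, but
   u_i = u_k or v_i = v_k on reserved ones; if b and b' are nonzero, no claimed pair is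
   reserved.  Pasch configurations are excluded by Menelaus' theorem.  This gives
   37 m^2 (m-1)^2 copies on 37 m^2 vertices; after recursing inside the blown-up vertices the
   density c of copies satisfies c = (1 + c)/37, that is, c = 1/36. *)

Set Implicit Arguments.
Unset Strict Implicit.
Unset Printing Implicit Defensive.

(** * The upper bound *)

Lemma cardU_le (V : finType) (A B : {set V}) c d k :
  #|A| <= c -> #|B| <= d -> k <= #|A :&: B| -> #|A :|: B| <= c + d - k.
Proof. by move=> hA hB hk; have := cardsUI A B; lia. Qed.

(** * Crowded edges: three edges on at most four vertices *)

Section Upper.
Variables (V : finType) (E : {set {set V}}).
Hypothesis E3 : Defs.rgraph 3 E.

Lemma edge_card e : e \in E -> #|e| = 3.
Proof. by move=> eE; move/forall_inP: E3 => /(_ e eE)/eqP. Qed.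

Lemma sk_free4 : sk_free 6 4 E ->
  forall e1 e2 e3 e4, e1 \in E -> e2 \in E -> e3 \in E -> e4 \in E ->
  uniq [:: e1; e2; e3; e4] -> 6 < #|e1 :|: e2 :|: e3 :|: e4|.
Proof.
move=> /forallP Efree e1 e2 e3 e4 h1 h2 h3 h4 u.
have /implyP := Efree [set e in [:: e1; e2; e3; e4]].
rewrite cardsE (card_uniqP u) eqxx andbT -ltnNge.
have -> : cover [set e in [:: e1; e2; e3; e4]] = e1 :|: e2 :|: e3 :|: e4.
  apply/setP=> x; apply/bigcupP/idP.
    by case=> e; rewrite !inE => /or4P[]/eqP-> ->; rewrite ?orbT.
  by rewrite !inE -!orbA => /or4P[] h;
     [exists e1 | exists e2 | exists e3 | exists e4]; rewrite // !inE eqxx ?orbT.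
apply; apply/subsetP=> e; rewrite !inE.
by case/or4P=> /eqP->.
Qed.

Hypothesis Efree : forall e1 e2 e3 e4,
  e1 \in E -> e2 \in E -> e3 \in E -> e4 \in E ->
  uniq [:: e1; e2; e3; e4] -> 6 < #|e1 :|: e2 :|: e3 :|: e4|.

Definition crowded : {set {set V}} :=
  [set e in E | [exists S : {set V}, [&& e \subset S, #|S| <= 4 &
     2 < #|[set f in E | f \subset S]|]]].


(** Take a crowded edge through [x], its set [S] and three edges [a], [b], [c] inside [S]. An edge
    through [x] not inside [S] adds at most two vertices to [S], a fourth edge inside [S] adds none;
    with [a], [b], [c] either would give four edges on six vertices. *)
Lemma crowded_degree x : #|[set e in crowded | x \in e]| <= 3.
Proof.
case: (set_0Vmem [set e in crowded | x \in e]) => [->|[e]]; first by rewrite cards0.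
rewrite !inE -andbA => /and3P[eE /existsP[S /and3P[eS S4 ES]] xe].
set F := [set f in E | f \subset S] in ES.
have /card_gt2P[a [b [c [[]]]]] := ES.
rewrite !inE => /andP[aE aS] /andP[bE bS] /andP[cE cS] [ab bc ca].
have no f : f \in E -> f \notin [set a; b; c] -> #|f :|: S| <= 6 -> False.
  rewrite !inE !negb_or => fE /andP[/andP[fa fb] fc] fS.
  have := Efree aE bE cE fE; rewrite /= !inE !negb_or ab bc eq_sym ca.
  rewrite eq_sym fa eq_sym fb eq_sym fc => /(_ isT).
  rewrite ltnNge => /negP; apply; apply: leq_trans fS; apply: subset_leq_card.
  by rewrite setUC setUS // !subUset aS bS cS.
have sF : [set e in crowded | x \in e] \subset F.
  apply/subsetP=> f; rewrite !inE -andbA => /and3P[fE _ xf]; rewrite fE /=.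
  apply/negP=> /negP fS; apply: (no f fE).
    by rewrite !inE !negb_or; do ![apply/andP; split]; apply: contraNneq fS => ->.
  apply: (@cardU_le V f S 3 4 1) => //; first by rewrite edge_card.
  by apply/card_gt0P; exists x; rewrite inE xf (subsetP eS).
apply: leq_trans (subset_leq_card sF) _.
rewrite leqNgt; apply/negP=> F4.
have : 0 < #|F :\: [set a; b; c]|.
  have c3 : #|[set a; b; c]| <= 3.
    by rewrite (leq_trans (leq_card_setU _ _)) // cards1 addn1 ltnS cards2; case: eqP.
  rewrite cardsD subn_gt0; apply: leq_ltn_trans F4.
  exact: leq_trans (subset_leq_card (subsetIr _ _)) c3.
case/card_gt0P=> f; rewrite inE => /andP[fn]; rewrite inE => /andP[fE fS].
by apply: (no f fE fn); rewrite (setUidPr fS); exact: leq_trans S4 _.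
Qed.

Lemma card_crowded : #|crowded| <= #|V|.
Proof.
have : \sum_(e in crowded) #|e| <= 3 * #|V|.
  have -> : \sum_(e in crowded) #|e| = \sum_x #|[set e in crowded | x \in e]|.
    under eq_bigr do rewrite -sum1_card.
    rewrite (exchange_big_dep predT) //=; apply: eq_bigr => x _.
    by rewrite -sum1_card; apply: eq_bigl => e; rewrite inE.
  rewrite -sum1_card big_distrr /=; apply: leq_sum => x _.
  by rewrite muln1 crowded_degree.
suff -> : \sum_(e in crowded) #|e| = 3 * #|crowded| by rewrite leq_pmul2l.
rewrite -sum1_card big_distrr /=; apply: eq_bigr => e.
by rewrite inE => /andP[/edge_card->].
Qed.
End Upper.

(** * Diamonds and missing pairs when no three edges span four vertices *)

Section Uncrowded.
Variables (V : finType) (E : {set {set V}}).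
Hypothesis E3 : Defs.rgraph 3 E.
Hypothesis Efree : forall e1 e2 e3 e4,
  e1 \in E -> e2 \in E -> e3 \in E -> e4 \in E ->
  uniq [:: e1; e2; e3; e4] -> 6 < #|e1 :|: e2 :|: e3 :|: e4|.
Hypothesis Esparse : forall e1 e2 e3, e1 \in E -> e2 \in E -> e3 \in E ->
  uniq [:: e1; e2; e3] -> 4 < #|e1 :|: e2 :|: e3|.


Let P := [set p : {set V} | #|p| == 2].
Let S := [set p in P | [exists e in E, p \subset e]].
(** Diamonds are ordered here, so each one occurs twice; this is the source of the factors 2
    below. *)
Let D := [set x : {set V} * {set V} |
  [&& x.1 \in E, x.2 \in E, x.1 != x.2 & 1 < #|x.1 :&: x.2|]].
Let sd (x : {set V} * {set V}) := (x.1 :|: x.2) :\: (x.1 :&: x.2).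

Lemma edgesI_le2 e f : e \in E -> f \in E -> e != f -> #|e :&: f| <= 2.
Proof.
move=> eE fE; apply: contraNT; rewrite -ltnNge => h.
have sef : e :&: f = e by apply/eqP; rewrite eqEcard subsetIl (edge_card E3 eE).
by rewrite eqEcard (edge_card E3 eE) (edge_card E3 fE) andbT -sef subsetIr.
Qed.

Lemma diamondI x : x \in D -> #|x.1 :&: x.2| = 2.
Proof.
by rewrite inE => /and4P[h1 h2 h12 h]; apply/eqP; rewrite eqn_leq edgesI_le2.
Qed.

Lemma diamondU x : x \in D -> #|x.1 :|: x.2| = 4.
Proof.
move=> xD; have := cardsUI x.1 x.2; rewrite (diamondI xD).
by move: xD; rewrite inE => /and4P[/(edge_card E3)-> /(edge_card E3)-> _ _]; lia.
Qed.

Lemma missing_card x : x \in D -> #|sd x| = 2.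
Proof.
move=> xD; rewrite cardsD (setIidPr _) ?diamondU ?diamondI //.
exact: subset_trans (subsetIl _ _) (subsetUl _ _).
Qed.

(** Two diamonds without a common edge are four edges on two 4-sets that share the missing pair,
    hence on six vertices. If they do have a common edge, its symmetric difference with the missing
    pair is the other edge of both. *)
Lemma missing_inj x y : x \in D -> y \in D -> sd x = sd y ->
  y = x \/ y = (x.2, x.1).
Proof.
move=> xD yD exy.
have sd2 z : z.2 = (z.1 :|: sd z) :\: (z.1 :&: sd z).
  by apply/setP=> v; rewrite !inE; do 2!case: (v \in _).
have sd1 z : z.1 = (z.2 :|: sd z) :\: (z.2 :&: sd z).
  by apply/setP=> v; rewrite !inE; do 2!case: (v \in _).
have [e11|n11] := eqVneq x.1 y.1.
  by left; rewrite (surjective_pairing x) (surjective_pairing y) sd2 -e11 -exy -sd2.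
have [e12|n12] := eqVneq x.1 y.2.
  by right; rewrite (surjective_pairing y) sd1 -e12 -exy -sd2.
have [e21|n21] := eqVneq x.2 y.1.
  by right; rewrite (surjective_pairing y) sd2 -e21 -exy -sd1.
have [e22|n22] := eqVneq x.2 y.2.
  by left; rewrite (surjective_pairing x) (surjective_pairing y) sd1 -e22 -exy -sd1.
have := xD; have := yD; rewrite !inE => /and4P[y1 y2 y12 _] /and4P[x1 x2 x12 _].
have := Efree x1 x2 y1 y2; rewrite /= !inE !negb_or x12 n11 n12 n21 n22 y12 => /(_ isT).
rewrite ltnNge -setUA => /negP[].
apply: (@cardU_le V _ _ 4 4 2); rewrite ?diamondU // -(missing_card xD).
by apply: subset_leq_card; rewrite subsetI {2}exy !subsetDl.
Qed.

Lemma card_missing (F : {set {set V} * {set V}}) :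
  F \subset D -> #|F| <= 2 * #|sd @: F|.
Proof.
move=> FD; rewrite -sum1_card (partition_big sd (mem (sd @: F))) /=; last first.
  by move=> x xF; apply: imset_f.
rewrite mulnC -sum_nat_const; apply: leq_sum => p _; rewrite sum1dep_card.
case: (set_0Vmem [set x in F | sd x == p]) => [->|[x]]; first by rewrite cards0.
rewrite inE => /andP[xF /eqP xp].
apply: (@leq_trans #|[set x; (x.2, x.1)]|); last by rewrite cards2; case: eqP.
apply: subset_leq_card; apply/subsetP=> y; rewrite !inE => /andP[yF /eqP yp].
have [|->|->] := missing_inj (subsetP FD _ xF) (subsetP FD _ yF).
- by rewrite xp yp.
- by rewrite eqxx.
- by rewrite eqxx orbT.
Qed.

Lemma edge_pairs e : e \in E -> #|[set p in P | p \subset e]| = 3.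
Proof.
move=> eE; have -> : 3 = 'C(#|e|, 2) by rewrite (edge_card E3 eE).
rewrite -cards_draws.
by apply: eq_card => p; rewrite !inE andbC.
Qed.

(** A pair lying in [d > 0] edges contributes [d] to [3 * #|E|], 1 to [#|S|], and at least
    [2 * (d - 1)] to [#|D|]: the ordered diamonds formed with one fixed edge [e0] on the pair. *)
Lemma count_diamonds : 6 * #|E| <= 2 * #|S| + #|D|.
Proof.
pose F (p : {set V}) := [set e in E | p \subset e].
have h1 : \sum_(p in P) #|F p| = 3 * #|E|.
  rewrite mulnC -sum_nat_const.
  under eq_bigr do rewrite -sum1_card.
  rewrite (exchange_big_dep (mem E)) /=; last by move=> p e _; rewrite inE => /andP[].
  apply: eq_bigr => e eE; rewrite -(edge_pairs eE) -sum1_card.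
  by apply: eq_bigl => p; rewrite !inE eE.
have h2 : \sum_(p in P) #|[set x in D | x.1 :&: x.2 == p]| = #|D|.
  rewrite -sum1_card (partition_big (fun x => x.1 :&: x.2) (mem P)) /=.
    by apply: eq_bigr => p _; rewrite sum1dep_card.
  by move=> x xD; rewrite inE diamondI.
have h3 : \sum_(p in P) (p \in S : nat) = #|S|.
  rewrite -sum1_card big_mkcond [RHS]big_mkcond; apply: eq_bigr => p _.
  by rewrite !inE; case: eqP => //=; case: ifP.
rewrite -h2 -h3 (_ : 6 * _ = 2 * \sum_(p in P) #|F p|); last by rewrite h1 mulnA.
rewrite !big_distrr -big_split /=.
apply: leq_sum => p pP.
case: (set_0Vmem (F p)) => [->|[e0 e0F]]; first by rewrite cards0.
have [e0E pe0] : e0 \in E /\ p \subset e0 by move: e0F; rewrite inE => /andP[].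
have -> : p \in S by rewrite inE pP; apply/exists_inP; exists e0.
pose A1 := [set (e0, e) | e in F p :\ e0]; pose A2 := [set (e, e0) | e in F p :\ e0].
have c1 : #|A1| = #|F p| - 1.
  by rewrite card_imset => [|? ? []//]; rewrite (cardsD1 e0 (F p)) e0F addKn.
have c2 : #|A2| = #|F p| - 1.
  by rewrite card_imset => [|? ? []//]; rewrite (cardsD1 e0 (F p)) e0F addKn.
have c12 : #|A1 :&: A2| = 0.
  apply/eqP; rewrite cards_eq0 -subset0; apply/subsetP=> x /setIP[/imsetP[e h ->]].
  by case/imsetP=> e' h' [e0e' _]; move: h'; rewrite !inE e0e' eqxx.
have sub : A1 :|: A2 \subset [set x in D | x.1 :&: x.2 == p].
  have key e : e \in F p :\ e0 ->
      [&& e0 \in E, e \in E, e0 != e, 1 < #|e0 :&: e| & e0 :&: e == p].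
    rewrite !inE => /and3P[ne eE pe]; rewrite e0E eE eq_sym ne /=.
    move: pP; rewrite inE => /eqP p2.
    have sp : p \subset e0 :&: e by rewrite subsetI pe0.
    rewrite -p2 (subset_leq_card sp) /= eq_sym eqEcard sp p2.
    by rewrite edgesI_le2 // eq_sym.
  apply/subsetP=> x /setUP[] /imsetP[e /key/and5P[? ? ? ? ?] ->]; rewrite !inE /=.
    by apply/andP; split=> //; apply/and4P.
  by rewrite setIC [e == _]eq_sym; apply/andP; split=> //; apply/and4P.
have := subset_leq_card sub; have := cardsUI A1 A2; rewrite c1 c2 c12.
rewrite addn0 => ->; have : 0 < #|F p| by apply/card_gt0P; exists e0.
by move: #|F p| #|[set x in D | _]| => a b; clear; lia.
Qed.

(** By [Esparse], [g] meets the diamond in the missing pair only, so the three edges span five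
    vertices; a further edge with two vertices there would complete four edges on six vertices. *)
Lemma covered_diamond x g : x \in D -> g \in E -> sd x \subset g ->
  [/\ #|g :&: x.1| <= 1, #|g :&: x.2| <= 1 &
  forall e, e \in E -> e != x.1 -> e != x.2 -> e != g ->
    #|e :&: (x.1 :|: x.2 :|: g)| <= 1].
Proof.
move=> xD gE sg; have := xD; rewrite inE => /and4P[x1 x2 x12 _].
have U4 := diamondU xD; have s2 := missing_card xD.
have sU : sd x \subset x.1 :|: x.2 by rewrite subsetDl.
(* An edge of the diamond contains the common pair; with the missing pair it would have four
   vertices. *)
have gx z : z = x.1 \/ z = x.2 -> z \in E -> #|sd x :&: z| <= 1.
  move=> zx zE; rewrite -ltnS -s2 proper_card // properEneq subsetIl andbT.
  apply/negP=> /eqP/setIidPl sz.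
  have : sd x :|: (x.1 :&: x.2) \subset z.
    by rewrite subUset sz; case: zx => ->; rewrite ?subsetIl ?subsetIr.
  have -> : sd x :|: x.1 :&: x.2 = x.1 :|: x.2.
    by apply/setP=> v; rewrite !inE; do 2!case: (v \in _).
  by move/subset_leq_card; rewrite U4 (edge_card E3 zE).
have gn1 : g != x.1.
  apply: contraTneq (gx _ (or_introl erefl) x1) => <-.
  by rewrite (setIidPl sg) s2.
have gn2 : g != x.2.
  apply: contraTneq (gx _ (or_intror erefl) x2) => <-.
  by rewrite (setIidPl sg) s2.
have gI : g :&: (x.1 :|: x.2) = sd x.
  apply/eqP; rewrite eq_sym eqEcard subsetI sg sU s2 /=.
  have := Esparse x1 x2 gE; rewrite /= !inE negb_or x12 eq_sym gn1 eq_sym gn2 => /(_ isT).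
  have := cardsUI (x.1 :|: x.2) g; rewrite U4 (edge_card E3 gE) setIC.
  by move: #|x.1 :|: x.2 :|: g| #|g :&: _| => a b; clear; lia.
split.
- apply: leq_trans (gx _ (or_introl erefl) x1); apply: subset_leq_card.
  by rewrite -gI subsetI subsetIr subsetI subsetIl subIset // subsetUl orbT.
- apply: leq_trans (gx _ (or_intror erefl) x2); apply: subset_leq_card.
  by rewrite -gI subsetI subsetIr subsetI subsetIl subIset // subsetUr orbT.
move=> e eE e1 e2 eg.
have := Efree x1 x2 gE eE; rewrite /= !inE !negb_or x12.
rewrite eq_sym gn1 eq_sym e1 eq_sym gn2 eq_sym e2 eq_sym eg => /(_ isT).
have := cardsUI (x.1 :|: x.2) g; rewrite setIC gI s2 U4 (edge_card E3 gE).
have := cardsUI (x.1 :|: x.2 :|: g) e; rewrite (edge_card E3 eE) [e :&: _]setIC.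
move: #|_ :&: e| #|_ :|: e| #|x.1 :|: x.2 :|: g| => a b c; clear; lia.
Qed.

Let Dc := [set x in D | sd x \in S].

(** An edge of a covered diamond determines its partner, so there are [#|Dc|] first edges [X]. The
    covering edges [Y] are disjoint from [X]; each contains at most three missing pairs, each of
    these from two ordered diamonds. Thus [#|Dc| <= 6 * #|Y|] and [#|Dc| + #|Y| <= #|E|]. *)
Lemma card_covered : 7 * #|Dc| <= 6 * #|E|.
Proof.
pose X := [set x.1 | x in Dc].
pose Y := [set g in E | [exists x in Dc, sd x \subset g]].
have DcP x : x \in Dc -> x \in D /\ exists2 g, g \in E & sd x \subset g.
  by rewrite inE => /andP[xD]; rewrite inE => /andP[_ /exists_inP].
have DP x : x \in D -> [/\ x.1 \in E, x.2 \in E, x.1 != x.2 & 1 < #|x.1 :&: x.2|].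
  by rewrite inE => /and4P.
have cX : #|X| = #|Dc|.
  apply: card_in_imset => x y /DcP[xD [g gE sg]] /DcP[yD _] exy.
  have [gx1 gx2 iso] := covered_diamond xD gE sg.
  have [_ y2 y12 yI] := DP _ yD.
  have [e2|n2] := eqVneq y.2 x.2.
    by rewrite (surjective_pairing x) exy -e2 -surjective_pairing.
  have [eg|ng] := eqVneq y.2 g.
    by move: yI; rewrite eg -exy setIC ltnNge gx1.
  have : #|y.2 :&: (x.1 :|: x.2 :|: g)| <= 1 by rewrite iso // exy eq_sym.
  rewrite leqNgt => /negP[]; apply: leq_trans yI (subset_leq_card _).
  by rewrite setIC setIS // exy -setUA subsetUl.
have XY : #|X :&: Y| = 0.
  apply/eqP; rewrite cards_eq0 -subset0; apply/subsetP=> g /setIP[/imsetP[y yc gy]].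
  rewrite inE => /andP[gE /exists_inP[x /DcP[xD _] sg]].
  have [yD _] := DcP _ yc; have [_ y2 y12 yI] := DP _ yD; rewrite -gy in y12 yI.
  have [gx1 gx2 iso] := covered_diamond xD gE sg.
  have [e1|n1] := eqVneq y.2 x.1; first by move: yI; rewrite e1 ltnNge gx1.
  have [e2|n2] := eqVneq y.2 x.2; first by move: yI; rewrite e2 ltnNge gx2.
  have : #|y.2 :&: (x.1 :|: x.2 :|: g)| <= 1 by rewrite iso // eq_sym.
  rewrite leqNgt => /negP[]; apply: leq_trans yI (subset_leq_card _).
  by rewrite setIC setIS // subsetUr.
have XYE : #|X :|: Y| <= #|E|.
  apply: subset_leq_card; rewrite subUset; apply/andP; split.
    by apply/subsetP=> e /imsetP[x /DcP[/DP[]]] ? ? ? ? _ ->.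
  by apply/subsetP=> e; rewrite inE => /andP[].
have DY : #|sd @: Dc| <= 3 * #|Y|.
  pose T := \bigcup_(g in Y) [set p in P | p \subset g].
  apply: (@leq_trans #|T|).
    apply: subset_leq_card; apply/subsetP=> _ /imsetP[x xc ->].
    have [xD [g gE sg]] := DcP _ xc.
    apply/bigcupP; exists g; last by rewrite !inE missing_card.
    by rewrite inE gE; apply/exists_inP; exists x.
  rewrite /T mulnC -sum_nat_const.
  apply: (@leq_trans (\sum_(g in Y) #|[set p in P | p \subset g]|)).
    elim/big_rec2: _ => [|g m U _ IH]; first by rewrite cards0.
    by apply: leq_trans (leq_card_setU _ _) _; rewrite leq_add2l.
  by apply: leq_sum => g; rewrite inE => /andP[/edge_pairs->].
have DcD : Dc \subset D by apply/subsetP=> x; rewrite inE => /andP[].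
have := card_missing DcD; have := cardsUI X Y; rewrite XY cX; move: XYE DY.
move: #|_ :|: _| #|Dc| #|Y| #|_ @: _| #|E| => a b c d e; clear; lia.
Qed.

(** Diamonds outside [Dc] have their missing pairs outside [S]. Inserting this into [count_diamonds]
    cancels [#|S|] and leaves [6|E| <= 2|P| + 6|E|/7]. *)
Lemma uncrowded_bound : 18 * #|E| <= 7 * 'C(#|V|, 2).
Proof.
rewrite -card_draws -/P.
have SP : S \subset P by apply/subsetP=> p; rewrite inE => /andP[].
have Du : #|D :\: Dc| <= 2 * #|P :\: S|.
  apply: leq_trans (card_missing _) _; first exact: subsetDl.
  rewrite leq_pmul2l //; apply: subset_leq_card; apply/subsetP=> _ /imsetP[x xu ->].
  move: xu; rewrite inE => /andP[xn xD]; move: xn; rewrite inE xD /= => nS.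
  by rewrite inE nS inE missing_card.
have DcD : Dc \subset D by apply/subsetP=> x; rewrite inE => /andP[].
have := card_covered; have := count_diamonds.
have := cardsID Dc D; rewrite (setIidPr DcD).
have := cardsID S P; rewrite (setIidPr SP); move: Du.
by move: #|_ :\: Dc| #|_ :\: S| #|Dc| #|S| #|D| #|P| #|E|; clear; lia.
Qed.
End Uncrowded.

Lemma sk_free_upper_bound (V : finType) (E : {set {set V}}) :
  Defs.rgraph 3 E -> sk_free 6 4 E -> 18 * #|E| <= 7 * 'C(#|V|, 2) + 18 * #|V|.
Proof.
move=> E3 Ef; have Efree := sk_free4 Ef.
pose F := E :\: crowded E.
have FE e : e \in F -> e \in E by rewrite inE => /andP[].
have Fb : 18 * #|F| <= 7 * 'C(#|V|, 2).
  apply: uncrowded_bound.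
  - by apply/forall_inP=> e /FE eE; apply: (forall_inP E3).
  - by move=> e1 e2 e3 e4 /FE h1 /FE h2 /FE h3 /FE h4; apply: Efree.
  move=> e1 e2 e3 h1 h2 h3 u; rewrite ltnNge; apply/negP=> U4.
  (* Otherwise [e1] would be crowded, with the union of the three edges as its set. *)
  move: (h1); rewrite !inE negb_and FE //= => /andP[/existsPn/(_ (e1 :|: e2 :|: e3))/negP[]].
  rewrite U4 -setUA subsetUl /=; apply/card_gt2P; exists e1, e2, e3.
  move: u; rewrite /= !inE negb_or andbT => /andP[/andP[n12 n13] n23].
  by rewrite !FE // subsetUl setUCA subsetUl setUA subsetUr [e3 == _]eq_sym n13 n12 n23.
have := card_crowded E3 Efree.
have := cardsID (crowded E) E; rewrite (setIidPr _) -/F; last first.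
  by apply/subsetP=> e; rewrite inE => /andP[].
by move: Fb; move: #|F| #|crowded E| #|E| => a b c; clear; lia.
Qed.

(** * The nine-vertex configuration *)

(* The central triangle 012 with the diamonds {034, 134}, {156, 256} and {078, 278}. *)
Definition triples : seq (nat * nat * nat) :=
  [:: (0, 1, 2); (0, 3, 4); (1, 3, 4); (1, 5, 6); (2, 5, 6); (0, 7, 8); (2, 7, 8)].

(** All six orders of each triple are listed, so that [triple] and [claimed] are symmetric and any
    two vertices of an edge can be named first. *)
Definition otriples : seq (nat * nat * nat) :=
  flatten [seq let: (i, k, l) := t in
    [:: (i, k, l); (i, l, k); (k, i, l); (k, l, i); (l, i, k); (l, k, i)] | t <- triples].

Definition triple i k l : bool := (i, k, l) \in otriples.

Definition claimed i k : bool := (i, k) \in [seq (t.1.1, t.1.2) | t <- otriples].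

(* The pairs whose addition to the diamond and the centre spans five vertices:
   a further edge on them would give four edges on six vertices. *)
Definition reserved : seq (nat * nat) :=
  [:: (2, 3); (2, 4); (0, 5); (0, 6); (1, 7); (1, 8)].

Definition reserved_pair i k : bool := ((i, k) \in reserved) || ((k, i) \in reserved).

Lemma triple_all (P : nat -> nat -> nat -> bool) :
  all (fun t => P t.1.1 t.1.2 t.2) otriples -> forall i k l, triple i k l -> P i k l.
Proof. by move=> /allP h i k l /h. Qed.

Lemma triple_facts i k l : triple i k l ->
  [&& i < 9, k < 9, l < 9, i != k, k != l, i != l,
      triple k i l, triple i l k, triple l k i & claimed i k].
Proof. by move: i k l; apply: triple_all; vm_compute. Qed.

Lemma triple_perm i k l a b d :
  triple i k l -> perm_eq [:: i; k; l] [:: a; b; d] -> triple a b d.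
Proof.
move=> h; rewrite perm_sym -mem_permutations => /(allP (_ : all
  (fun s => triple (nth 0 s 0) (nth 0 s 1) (nth 0 s 2)) (permutations [:: i; k; l]))).
by apply; move: i k l h; apply: triple_all; vm_compute.
Qed.

Lemma claimed_triple i k : claimed i k -> exists l, triple i k l.
Proof. by case/mapP=> -[[a b] l] h [-> ->]; exists l. Qed.

Definition diamonds : seq (nat * nat * nat * nat) :=
  flatten [seq [seq (t, s.2) | s <- otriples & (s.1 == t.1) && (s.2 != t.2)] | t <- otriples].

Lemma diamond_all (P : nat -> nat -> nat -> nat -> bool) :
  all (fun d => P d.1.1.1 d.1.1.2 d.1.2 d.2) diamonds ->
  forall i k l m, triple i k l -> triple i k m -> l != m -> P i k l m.
Proof.
move=> /allP h i k l m hl hm lm; apply: (h (i, k, l, m)).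
apply/flatten_mapP; exists (i, k, l) => //; apply/mapP; exists (i, k, m) => //.
by rewrite mem_filter /= eqxx eq_sym lm.
Qed.

(** The missing pair of each diamond is a side of the central triangle and therefore claimed as
    well. *)
Lemma diamond_clique i k l m : triple i k l -> triple i k m -> l != m ->
  all (fun q => (q < 9) && all (fun p => (q == p) || claimed q p) [:: i; k; l; m]) [:: i; k; l; m]
  && uniq [:: i; k; l; m].
Proof. by move: i k l m; apply: diamond_all; vm_compute. Qed.

(** Here [Q] is a diamond and [a], [b] lie on it. Either [abd] is an edge of the diamond, or it is
    the central triangle. In the latter case it is the only triple with two positions in [Q] and the
    third outside, and each pair from [Q] to [d] is reserved or claimed by this triple alone. *)
Definition center_spec i k l m a b d :=
  let Q := [:: i; k; l; m] in
  if ~~ ((a \in Q) && (b \in Q)) then true else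
  if d \in Q then perm_eq [:: a; b; d] [:: i; k; l] || perm_eq [:: a; b; d] [:: i; k; m]
  else all (fun q => (claimed q d || reserved_pair q d) &&
         all (fun t => if (t.1.1 == q) && (t.1.2 == d)
                       then perm_eq [:: t.1.1; t.1.2; t.2] [:: a; b; d] else true) otriples) Q
       && all (fun t => if [&& t.1.1 \in Q, t.1.2 \in Q & t.2 \notin Q]
                       then perm_eq [:: t.1.1; t.1.2; t.2] [:: a; b; d] else true) otriples.

Lemma diamond_center i k l m a b d :
  triple i k l -> triple i k m -> l != m -> triple a b d -> center_spec i k l m a b d.
Proof.
move=> hl hm lm; move: a b d; apply: triple_all; move: i k l m hl hm lm.
by apply: diamond_all; vm_compute.
Qed.

(** The three diamonds have different sides of the central triangle as missing pairs, and a diamond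
    contains no side but its own; so [p] and [q] in [Q] force the two diamonds to agree. *)
Lemma diamonds_share i k l m a b p q :
  triple i k l -> triple i k m -> l != m -> triple a b p -> triple a b q -> p != q ->
  if (p \in [:: i; k; l; m]) && (q \in [:: i; k; l; m]) then a \in [:: i; k; l; m] else true.
Proof.
move=> hl hm lm; move: a b p q; apply: diamond_all; move: i k l m hl hm lm.
by apply: diamond_all; vm_compute.
Qed.

(** * Systems of compatible copies *)

Definition triple_of (V I : Type) (phi : I -> nat -> V) x y z : Prop :=
  exists t i k l, [/\ triple i k l, x = phi t i, y = phi t k & z = phi t l].

Record system (V I : Type) (phi : I -> nat -> V) : Prop := System {
  sys_inj : forall t i k, i < 9 -> k < 9 -> phi t i = phi t k -> i = k;
  sys_claim : forall t t' i k i' k', claimed i k -> claimed i' k' ->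
    phi t i = phi t' i' -> phi t k = phi t' k' -> t = t';
  sys_reserved : forall t t' i k i' k', claimed i k -> reserved_pair i' k' ->
    phi t i = phi t' i' -> phi t k = phi t' k' -> False;
  sys_pasch : forall x12 x13 x14 x23 x24 x34,
    triple_of phi x12 x13 x14 -> triple_of phi x12 x23 x24 ->
    triple_of phi x13 x23 x34 -> triple_of phi x14 x24 x34 ->
    x12 <> x34 -> x13 <> x24 -> x14 <> x23 -> False }.

(** * Triples that meet pairwise in at most one vertex *)

Section LinearTriples.
Variable V : finType.
Implicit Types e f g : {set V}.

(** If [e] and [f] were disjoint, they would cover six vertices, and [g], meeting each at most once,
    would add a seventh. *)
Lemma linear_meet e f g : #|e| = 3 -> #|f| = 3 -> #|g| = 3 ->
  #|e :&: g| <= 1 -> #|f :&: g| <= 1 -> #|e :|: f :|: g| <= 6 -> exists x, x \in e :&: f.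
Proof.
move=> e3 f3 g3 eg fg U; apply/card_gt0P; rewrite lt0n; apply/negP=> /eqP ef0.
have h1 : #|e :|: f| = 6 by have := cardsUI e f; rewrite ef0 e3 f3 addn0.
have := cardsUI (e :|: f) g; rewrite h1 g3 setIUl.
have [h2 _] := leq_card_setU (e :&: g) (f :&: g).
move: eg fg U h2; move: #|e :&: g| #|f :&: g| #|_ :|: _ :&: _| #|e :|: f :|: g| => a b c d.
by clear; lia.
Qed.

Lemma linear_not_concurrent e f g x : #|e| = 3 -> #|f| = 3 -> #|g| = 3 ->
  #|e :&: f| <= 1 -> #|e :&: g| <= 1 -> #|f :&: g| <= 1 ->
  x \in e -> x \in f -> x \in g -> 6 < #|e :|: f :|: g|.
Proof.
move=> e3 f3 g3 ef eg fg xe xf xg.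
have I1 (A : {set V}) : #|A| <= 1 -> x \in A -> A \subset [set x].
  by move=> A1 xA; apply/subsetP=> y yA; rewrite inE (card_le1_eqP A1 _ _ yA xA).
have h : #|(e :|: f) :&: g| <= 1.
  rewrite setIUl -(cards1 x); apply: subset_leq_card.
  by rewrite subUset !I1 // inE ?xe ?xf ?xg.
have := cardsUI (e :|: f) g; have := cardsUI e f; rewrite e3 f3 g3.
move: ef h; move: #|e :&: f| #|e :|: f| #|_ :&: g| #|_ :|: _ :|: g| => a b c d.
by clear; lia.
Qed.
End LinearTriples.

(** * The hypergraph of a system has no four edges on six vertices *)

Section SystemFree.
Variables (V I : finType) (phi : I -> nat -> V).
Hypothesis Sphi : system phi.

Definition tedge t i k l : {set V} := [set x in [seq phi t j | j <- [:: i; k; l]]].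

Definition edges : {set {set V}} :=
  [set tedge x.1 (nth (0, 0, 0) triples x.2).1.1 (nth (0, 0, 0) triples x.2).1.2
         (nth (0, 0, 0) triples x.2).2 | x : I * 'I_7].

Lemma tedge_perm t i k l a b d :
  perm_eq [:: i; k; l] [:: a; b; d] -> tedge t i k l = tedge t a b d.
Proof. by move=> h; apply/setP=> x; rewrite !in_set; apply: perm_mem; apply: perm_map h. Qed.

Lemma sys_neq t i k : i < 9 -> k < 9 -> i != k -> phi t i != phi t k.
Proof. by move=> hi hk; apply: contraNneq => /(sys_inj Sphi hi hk)->. Qed.

Lemma card_tedge t i k l : triple i k l -> #|tedge t i k l| = 3.
Proof.
move=> /triple_facts/and5P[hi hk hl ik /and5P[kl il _ _ _]].
rewrite cardsE (card_uniqP _) //= !inE !negb_or.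
by rewrite !sys_neq.
Qed.

Lemma triples_triple j : j < 7 ->
  triple (nth (0, 0, 0) triples j).1.1 (nth (0, 0, 0) triples j).1.2 (nth (0, 0, 0) triples j).2.
Proof. by do 7![case: j => [//|j]]. Qed.

Lemma edgesP e : e \in edges -> exists t i k l, triple i k l /\ e = tedge t i k l.
Proof.
case/imsetP=> -[t j] _ ->; exists t; do 3!eexists; split; last by [].
exact: triples_triple.
Qed.

Lemma tedge2 t i k l x y : triple i k l -> x \in tedge t i k l -> y \in tedge t i k l ->
  x != y -> exists a b d, [/\ perm_eq [:: i; k; l] [:: a; b; d], x = phi t a & y = phi t b].
Proof.
move=> h; rewrite !inE => /or3P[] /eqP-> /or3P[] /eqP->; rewrite ?eqxx // => _;
  [exists i, k, l | exists i, l, k | exists k, i, l | exists k, l, i | exists l, i, k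
  | exists l, k, i]; split=> //; apply/permP=> p /=;
  by case: (p i); case: (p k); case: (p l).
Qed.

Lemma edge2 e x y : e \in edges -> x \in e -> y \in e -> x != y ->
  exists t i k l, [/\ triple i k l, x = phi t i, y = phi t k & e = tedge t i k l].
Proof.
case/edgesP=> t [i [k [l [h ->]]]] xe ye xy.
have [a [b [d [p ex ey]]]] := tedge2 h xe ye xy; exists t, a, b, d.
by split=> //; [apply: triple_perm h p | apply: tedge_perm].
Qed.

Lemma edge3 e x y z : e \in edges -> x \in e -> y \in e -> z \in e ->
  x != y -> x != z -> y != z -> triple_of phi x y z.
Proof.
move=> eE xe ye ze xy xz yz; have [t [i [k [l [h ex ey ee]]]]] := edge2 eE xe ye xy.
exists t, i, k, l; split=> //; move: ze; rewrite ee !inE -ex -ey.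
by rewrite eq_sym (negPf xz) eq_sym (negPf yz) => /eqP.
Qed.

(** Two vertices of an edge form a claimed pair, which determines the copy; inside a copy positions
    are distinct, and the seven triples differ as sets. *)
Lemma card_edges : #|edges| = 7 * #|I|.
Proof.
rewrite card_imset; first by rewrite card_prod card_ord mulnC.
move=> [t j] [t' j'] /=.
have := triples_triple (ltn_ord j); have := triples_triple (ltn_ord j').
set a := nth _ _ j; set a' := nth _ _ j' => h' h E.
have /and5P[l1 l2 l3 n12 /and5P[n23 n13 _ _ /andP[_ c]]] := triple_facts h.
have [||b1 [b2 [b3 [p e1 e2]]]] := tedge2 (t := t') h' _ _ (sys_neq t l1 l2 n12).
- by rewrite -E !inE eqxx.
- by rewrite -E !inE eqxx orbT.
have h1 := triple_perm h' p.
have /and5P[l1' l2' l3' _ /and5P[_ _ _ _ /andP[_ c1]]] := triple_facts h1.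
have tt' := sys_claim Sphi c c1 e1 e2; rewrite -tt' in e1 e2 E *.
have e11 := sys_inj Sphi l1 l1' e1; have e22 := sys_inj Sphi l2 l2' e2.
have : phi t a.2 \in tedge t b1 b2 b3 by rewrite -(tedge_perm t p) -E !inE eqxx !orbT.
rewrite !inE -e11 -e22 eq_sym (negPf (sys_neq t l1 l3 n13)).
rewrite eq_sym (negPf (sys_neq t l2 l3 n23)) => /eqP /(sys_inj Sphi l3 l3') e33.
move: p; rewrite -e11 -e22 -e33 /a /a' => p; congr (_, _); apply: val_inj => /=.
have /allP/(_ j) : all (fun x => all (fun y => let c := nth (0, 0, 0) triples x in
  let c' := nth (0, 0, 0) triples y in
  perm_eq [:: c'.1.1; c'.1.2; c'.2] [:: c.1.1; c.1.2; c.2] ==> (x == y))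
  (iota 0 7)) (iota 0 7) by vm_compute.
rewrite mem_iota ltn_ord => /(_ isT) /allP/(_ j').
by rewrite mem_iota ltn_ord => /(_ isT) /implyP/(_ p)/eqP.
Qed.

(** The shared pair is claimed by the copies of both edges, so the copies coincide. *)
Lemma diamond_edges e f x y : e \in edges -> f \in edges -> e != f ->
  x \in e -> y \in e -> x \in f -> y \in f -> x != y ->
  exists t i k l m, [/\ triple i k l, triple i k m & l != m] /\
    [/\ x = phi t i, y = phi t k, e = tedge t i k l & f = tedge t i k m].
Proof.
move=> eE fE ef xe ye xf yf xy.
have [t [i [k [l [h ex ey ee]]]]] := edge2 eE xe ye xy.
have [t' [i' [k' [m [h' ex' ey' ef']]]]] := edge2 fE xf yf xy.
have /and5P[l1 l2 _ _ /and5P[_ _ _ _ /andP[_ c]]] := triple_facts h.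
have /and5P[l1' l2' _ _ /and5P[_ _ _ _ /andP[_ c']]] := triple_facts h'.
have tt' : t = t' by apply: (sys_claim Sphi c c'); rewrite -?ex -?ey.
move: ex' ey' ef'; rewrite -tt' ex ey => /(sys_inj Sphi l1 l1') ei /(sys_inj Sphi l2 l2') ek.
rewrite -ei -ek in h' * => ef'.
exists t, i, k, l, m; split=> //; split=> //.
by apply: contraNneq ef => lm; rewrite ee ef' lm.
Qed.

Section Diamond.
Variables (t : I) (i k l m : nat).
Hypotheses (hl : triple i k l) (hm : triple i k m) (lm : l != m).
Let Q := [:: i; k; l; m].
Let S := tedge t i k l :|: tedge t i k m.

Lemma memS x : x \in S -> exists2 q, q \in Q & x = phi t q.
Proof.
rewrite !inE -!orbA => /or4P[|||/or3P[]] /eqP->; do [by exists i; rewrite ?inE ?eqxx ?orbT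
 | by exists k; rewrite ?inE ?eqxx ?orbT | by exists l; rewrite ?inE ?eqxx ?orbT
 | by exists m; rewrite ?inE ?eqxx ?orbT].
Qed.

Lemma Qmem q : q \in Q -> phi t q \in S.
Proof. by rewrite !inE => /or4P[] /eqP->; rewrite eqxx ?orbT. Qed.

Lemma Q9 q : q \in Q -> q < 9.
Proof.
have /andP[/allP h _] := diamond_clique hl hm lm.
by move/h=> /andP[].
Qed.

Lemma Qcl q p : q \in Q -> p \in Q -> q != p -> claimed q p.
Proof.
have /andP[/allP h _] := diamond_clique hl hm lm.
by move/h=> /andP[_ /allP h'] /h' /orP[->|].
Qed.

Lemma card_diamond : #|S| = 4.
Proof.
have /andP[_ u] := diamond_clique hl hm lm.
have -> : S = [set x in [seq phi t q | q <- Q]].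
  apply/setP=> x; rewrite in_set; apply/idP/mapP.
    by case/memS=> q; exists q.
  by case=> q /Qmem h ->.
rewrite cardsE (card_uniqP _) // map_inj_in_uniq // => p q /Q9 hp /Q9 hq.
exact: sys_inj.
Qed.

(** All pairs of the diamond are claimed by copy [t], so [e] belongs to that copy; [center_spec]
    then makes it the central triangle. *)
Lemma edge_on_diamond e : e \in edges -> e != tedge t i k l -> e != tedge t i k m ->
  1 < #|e :&: S| -> exists a b d,
  [/\ triple a b d, a \in Q, b \in Q, d \notin Q & e = tedge t a b d].
Proof.
move=> eE el em /card_gt1P[x [y [/setIP[xe xS] /setIP[ye yS] xy]]].
have [q qQ xq] := memS xS; have [p pQ yp] := memS yS.
have qp : q != p by apply: contraNneq xy => qp; rewrite xq yp qp.
have [t' [a [b [d [h ex ey ee]]]]] := edge2 eE xe ye xy.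
have /and5P[l1 l2 _ _ /and5P[_ _ _ _ /andP[_ c]]] := triple_facts h.
have tt' : t = t' by apply: (sys_claim Sphi (Qcl qQ pQ qp) c); rewrite -?xq -?yp.
rewrite -{}tt' in ex ey ee.
have qa := sys_inj Sphi (Q9 qQ) l1 (etrans (esym xq) ex).
have pb := sys_inj Sphi (Q9 pQ) l2 (etrans (esym yp) ey).
rewrite {}qa {}pb in qQ pQ.
exists a, b, d; split=> //; apply/negP=> dQ.
have := diamond_center hl hm lm h; rewrite /center_spec -/Q qQ pQ dQ /=.
by case/orP=> /(tedge_perm t) ep; move: el em; rewrite ee ep eqxx.
Qed.

(** The diamond and its centre [e] span five vertices; [f] meets them at most once, which makes
    [5 + 3 - 1 = 7]. *)
Lemma center_edge e f : e \in edges -> f \in edges -> e != f ->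
  e != tedge t i k l -> e != tedge t i k m -> f != tedge t i k l -> f != tedge t i k m ->
  1 < #|e :&: S| -> 6 < #|S :|: e :|: f|.
Proof.
move=> eE fE ef el em fl fm eS.
have [a [b [d [h aQ bQ dQ ee]]]] := edge_on_diamond eE el em eS.
have := diamond_center hl hm lm h; rewrite /center_spec -/Q aQ bQ [~~ _]/= (negPf dQ).
case/andP=> /allP hq /allP hc.
have fS : #|f :&: S| <= 1.
  rewrite leqNgt; apply/negP=> /(edge_on_diamond fE fl fm)[a' [b' [d' [h' aQ' bQ' dQ' fe]]]].
  have := hc _ h'; rewrite /= aQ' bQ' dQ' => /(tedge_perm t).
  by rewrite -ee -fe => fe'; rewrite fe' eqxx in ef.
have d9 : d < 9 by have /and5P[_ _ ? _ _] := triple_facts h.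
have dS : phi t d \notin S.
  by apply/negP=> /memS[q qQ /(sys_inj Sphi d9 (Q9 qQ)) dq]; rewrite dq qQ in dQ.
have dE : phi t d \in e by rewrite ee !inE eqxx !orbT.
(* If the pair is claimed, [f] lies in copy [t] and equals [e]; if it is reserved, no edge may
   contain it. *)
have key q : q \in Q -> phi t q \in f -> phi t d \in f -> False.
  move=> qQ qf df.
  have qd : phi t q != phi t d by apply: contraNneq dS => <-; apply: Qmem.
  have [t' [a' [b' [d' [h' ex ey fe]]]]] := edge2 fE qf df qd.
  have /and5P[l1 l2 _ _ /and5P[_ _ _ _ /andP[_ c]]] := triple_facts h'.
  have /andP[/orP[cqd|rqd] /allP hp] := hq _ qQ; last first.
    by apply: (sys_reserved Sphi c rqd); symmetry; [exact: ex | exact: ey].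
  have tt' : t = t' by apply: (sys_claim Sphi cqd c).
  rewrite -{}tt' in ex ey fe.
  have qa := sys_inj Sphi (Q9 qQ) l1 ex; have db := sys_inj Sphi d9 l2 ey.
  have := hp _ h'; rewrite /= -qa -db !eqxx /= => /(tedge_perm t).
  by rewrite -ee qa db -fe => fe'; rewrite fe' eqxx in ef.
have Sf : (phi t d |: S) :&: f \subset [set phi t d] :|: f :&: S.
  by apply/subsetP=> x; rewrite !inE; case: (x \in f); rewrite ?andbT ?andbF.
have le1 : #|(phi t d |: S) :&: f| <= 1.
  rewrite leqNgt; apply/negP=> /card_gt1P[x [y [/setIP[xS xf] /setIP[yS yf] xy]]].
  move: xS yS; rewrite !in_setU1 => /orP[/eqP xd|xS] /orP[/eqP yd|yS].
  - by rewrite xd yd eqxx in xy.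
  - by have [q qQ yq] := memS yS; apply: (key q) => //; rewrite -?yq -?xd.
  - by have [q qQ xq] := memS xS; apply: (key q) => //; rewrite -?xq -?yd.
  - have : x \in f :&: S by rewrite inE xf.
    have : y \in f :&: S by rewrite inE yf.
    by move=> h1 h2; rewrite (card_le1_eqP fS _ _ h1 h2) eqxx in xy.
have sub : (phi t d |: S) :|: f \subset S :|: e :|: f.
  by rewrite setSU // subUset sub1set inE dE orbT subsetUl.
apply: leq_trans (subset_leq_card sub).
have := cardsUI (phi t d |: S) f; rewrite cardsU1 dS card_diamond.
have -> : #|f| = 3.
  by have [t' [a' [b' [d' [h' ->]]]]] := edgesP fE; rewrite card_tedge.
move: le1; move: #|_ :&: f| #|_ :|: f| => u v; clear; lia.
Qed.

(** Each of [e] and [f] adds at least two vertices to the four of [S]. On six vertices both add the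
    same two, so [e] and [f] form a diamond whose missing pair lies in [S]. That pair is claimed, so
    the copies agree, and [diamonds_share] puts a new vertex into [S]. *)
Lemma no_center_edge e f : e \in edges -> f \in edges -> e != f ->
  #|e :&: S| <= 1 -> #|f :&: S| <= 1 -> 6 < #|S :|: e :|: f|.
Proof.
move=> eE fE ef eS fS.
have [e3 f3] : #|e| = 3 /\ #|f| = 3.
  have [? [? [? [? [h ->]]]]] := edgesP eE; have [? [? [? [? [h' ->]]]]] := edgesP fE.
  by rewrite !card_tedge.
rewrite ltnNge; apply/negP=> U.
have fU : f \subset S :|: e.
  have := cardsUI (S :|: e) f; have := cardsUI S e; rewrite card_diamond e3 f3 setIC => h1 h2.
  suff : f == (S :|: e) :&: f by move/eqP->; apply: subsetIl.
  rewrite eq_sym eqEcard subsetIr f3 /=.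
  move: eS U h1 h2; move: #|e :&: S| #|S :|: e| #|_ :|: f| #|_ :&: f| => a b c d.
  by clear; lia.
have eU : e \subset S :|: f.
  have := cardsUI (S :|: f) e; have := cardsUI S f; rewrite card_diamond e3 f3 setIC => h1 h2.
  suff : e == (S :|: f) :&: e by move/eqP->; apply: subsetIl.
  rewrite eq_sym eqEcard subsetIr e3 /=; move: U; rewrite -setUA [e :|: f]setUC setUA.
  move: fS h1 h2; move: #|f :&: S| #|S :|: f| #|_ :|: e| #|_ :&: e| => a b c d.
  by clear; lia.
have : 1 < #|f :\: S|.
  by have := cardsID S f; rewrite f3; move: fS; move: #|_ :&: S| #|_ :\: S|; clear; lia.
case/card_gt1P=> x [y [/setDP[xf xS] /setDP[yf yS] xy]].
have xe : x \in e by have := subsetP fU _ xf; rewrite in_setU (negPf xS).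
have ye : y \in e by have := subsetP fU _ yf; rewrite in_setU (negPf yS).
have [t2 [a [b [p [q [[hp hq pq] [xa yb ee ff]]]]]]] := diamond_edges eE fE ef xe ye xf yf xy.
have /and5P[a9 b9 p9 ab /and5P[bp ap _ _ _]] := triple_facts hp.
have /and5P[_ _ q9 _ /and5P[bq aq _ _ _]] := triple_facts hq.
have cpq : claimed p q.
  have /andP[/allP h _] := diamond_clique hp hq pq.
  have pin : p \in [:: a; b; p; q] by rewrite !inE eqxx !orbT.
  have /andP[_ /allP/(_ q)] := h p pin; rewrite !inE eqxx !orbT (negPf pq).
  exact.
have [p' pQ' pp] : exists2 p', p' \in Q & phi t2 p = phi t p'.
  apply: memS; have : phi t2 p \in S :|: f.
    by apply: (subsetP eU); rewrite ee !inE eqxx !orbT.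
  rewrite in_setU => /orP[//|]; rewrite ff !inE eq_sym (negPf (sys_neq t2 a9 p9 ap)).
  by rewrite eq_sym (negPf (sys_neq t2 b9 p9 bp)) (negPf (sys_neq t2 p9 q9 pq)).
have [q' qQ' qq] : exists2 q', q' \in Q & phi t2 q = phi t q'.
  apply: memS; have : phi t2 q \in S :|: e.
    by apply: (subsetP fU); rewrite ff !inE eqxx !orbT.
  rewrite in_setU => /orP[//|]; rewrite ee !inE eq_sym (negPf (sys_neq t2 a9 q9 aq)).
  by rewrite eq_sym (negPf (sys_neq t2 b9 q9 bq)) eq_sym (negPf (sys_neq t2 p9 q9 pq)).
have pq' : p' != q'.
  apply: contraNneq (sys_neq t2 p9 q9 pq) => e'; by rewrite pp qq e'.
have tt2 := sys_claim Sphi cpq (Qcl pQ' qQ' pq') pp qq.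
rewrite tt2 in pp qq xa.
have ep := sys_inj Sphi p9 (Q9 pQ') pp; have eq := sys_inj Sphi q9 (Q9 qQ') qq.
have := diamonds_share hl hm lm hp hq pq; rewrite -/Q ep eq pQ' qQ' /= => aQ.
by move: xS; rewrite xa Qmem.
Qed.

Lemma diamond_free e f : e \in edges -> f \in edges -> e != f ->
  e != tedge t i k l -> e != tedge t i k m -> f != tedge t i k l -> f != tedge t i k m ->
  6 < #|S :|: e :|: f|.
Proof.
move=> eE fE ef el em fl fm.
have [eS|eS] := ltnP 1 #|e :&: S|; first exact: center_edge.
have [fS|fS] := ltnP 1 #|f :&: S|; last exact: no_center_edge.
by rewrite -setUA [e :|: f]setUC setUA; apply: center_edge; rewrite // eq_sym.
Qed.
End Diamond.

Lemma four_edges_diamond e1 e2 e3 e4 :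
  e1 \in edges -> e2 \in edges -> e3 \in edges -> e4 \in edges ->
  uniq [:: e1; e2; e3; e4] -> 1 < #|e1 :&: e2| -> 6 < #|e1 :|: e2 :|: e3 :|: e4|.
Proof.
move=> h1 h2 h3 h4; rewrite /= !inE !negb_or.
case/and4P=> /and3P[n12 n13 n14] /andP[n23 n24] n34 _.
case/card_gt1P=> x [y [/setIP[x1 x2] /setIP[y1 y2] xy]].
have [t [i [k [l [m [[hl hm lm] [_ _ ee1 ee2]]]]]]] :=
  diamond_edges h1 h2 n12 x1 y1 x2 y2 xy.
rewrite ee1 ee2 in n13 n14 n23 n24 *.
by apply: diamond_free; rewrite // eq_sym.
Qed.

(** On six vertices any two of the edges meet and no three are concurrent; the six meeting points
    form a Pasch configuration. *)
Lemma four_edges_linear e1 e2 e3 e4 :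
  e1 \in edges -> e2 \in edges -> e3 \in edges -> e4 \in edges ->
  #|e1 :&: e2| <= 1 -> #|e1 :&: e3| <= 1 -> #|e1 :&: e4| <= 1 ->
  #|e2 :&: e3| <= 1 -> #|e2 :&: e4| <= 1 -> #|e3 :&: e4| <= 1 ->
  6 < #|e1 :|: e2 :|: e3 :|: e4|.
Proof.
move=> h1 h2 h3 h4 i12 i13 i14 i23 i24 i34; rewrite ltnNge; apply/negP=> U.
have c e : e \in edges -> #|e| = 3.
  by case/edgesP=> t [i [k [l [h ->]]]]; apply: card_tedge.
pose T := e1 :|: e2 :|: e3 :|: e4.
have sT (e f g : {set V}) : e \subset T -> f \subset T -> g \subset T -> #|e :|: f :|: g| <= 6.
  move=> he hf hg; apply: leq_trans U; apply: subset_leq_card.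
  by rewrite !subUset he hf hg.
have s1 : e1 \subset T by rewrite /T -!setUA subsetUl.
have s2 : e2 \subset T by rewrite /T [e1 :|: _]setUC -!setUA subsetUl.
have s3 : e3 \subset T by rewrite /T [_ :|: e3]setUC -!setUA subsetUl.
have s4 : e4 \subset T by rewrite /T subsetUr.
have meet (e f g : {set V}) : e \in edges -> f \in edges -> g \in edges -> e \subset T ->
    f \subset T -> g \subset T -> #|e :&: g| <= 1 -> #|f :&: g| <= 1 ->
    exists2 x, x \in e & x \in f.
  move=> he hf hg se sf sg eg fg.
  have [x /setIP[]] := linear_meet (c _ he) (c _ hf) (c _ hg) eg fg (sT _ _ _ se sf sg).
  by exists x.
have conc (e f g : {set V}) x y : e \in edges -> f \in edges -> g \in edges -> e \subset T ->
    f \subset T -> g \subset T -> #|e :&: f| <= 1 -> #|e :&: g| <= 1 -> #|f :&: g| <= 1 ->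
    x \in e -> x \in f -> y \in e -> y \in g -> x != y.
  move=> he hf hg se sf sg ef eg fg xe xf ye yg; apply/eqP=> xy.
  have := linear_not_concurrent (c _ he) (c _ hf) (c _ hg) ef eg fg xe xf.
  by rewrite xy => /(_ yg); rewrite ltnNge sT.
have [x12 a1 a2] : exists2 x, x \in e1 & x \in e2 by apply: (meet _ _ e3).
have [x13 b1 b3] : exists2 x, x \in e1 & x \in e3 by apply: (meet _ _ e2); rewrite // setIC.
have [x14 c1 c4] : exists2 x, x \in e1 & x \in e4 by apply: (meet _ _ e2); rewrite // setIC.
have [x23 d2 d3] : exists2 x, x \in e2 & x \in e3
  by apply: (meet _ _ e1); rewrite // setIC.
have [x24 f2 f4] : exists2 x, x \in e2 & x \in e4
  by apply: (meet _ _ e1); rewrite // setIC.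
have [x34 g3 g4] : exists2 x, x \in e3 & x \in e4
  by apply: (meet _ _ e1); rewrite // setIC.
have i21 : #|e2 :&: e1| <= 1 by rewrite setIC.
have i31 : #|e3 :&: e1| <= 1 by rewrite setIC.
have i41 : #|e4 :&: e1| <= 1 by rewrite setIC.
have i32 : #|e3 :&: e2| <= 1 by rewrite setIC.
have i42 : #|e4 :&: e2| <= 1 by rewrite setIC.
have i43 : #|e4 :&: e3| <= 1 by rewrite setIC.
apply: (sys_pasch Sphi (x12 := x12) (x13 := x13) (x14 := x14) (x23 := x23) (x24 := x24)
  (x34 := x34)).
- apply: (edge3 h1) => //; [exact: (conc e1 e2 e3)|exact: (conc e1 e2 e4)|exact: (conc e1 e3 e4)].
- apply: (edge3 h2) => //; [exact: (conc e2 e1 e3)|exact: (conc e2 e1 e4)|exact: (conc e2 e3 e4)].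
- apply: (edge3 h3) => //; [exact: (conc e3 e1 e2)|exact: (conc e3 e1 e4)|exact: (conc e3 e2 e4)].
- apply: (edge3 h4) => //; [exact: (conc e4 e1 e2)|exact: (conc e4 e1 e3)|exact: (conc e4 e2 e3)].
- move=> E; suff : x12 != x12 by rewrite eqxx.
  by apply: (conc e1 e2 e3); rewrite // E.
- move=> E; suff : x13 != x13 by rewrite eqxx.
  by apply: (conc e1 e3 e2); rewrite // E.
- move=> E; suff : x14 != x14 by rewrite eqxx.
  by apply: (conc e1 e4 e2); rewrite // E.
Qed.

Lemma system_rgraph : Defs.rgraph 3 edges.
Proof.
by apply/forall_inP=> e /edgesP[t [i [k [l [h ->]]]]]; rewrite card_tedge.
Qed.

Lemma system_sk_free : sk_free 6 4 edges.
Proof.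
apply/forallP=> F; apply/implyP=> /andP[/subsetP FE /eqP F4]; rewrite -ltnNge.
have [e1 [e2 [e3 [e4 [u mF]]]]] : exists e1 e2 e3 e4,
    uniq [:: e1; e2; e3; e4] /\ F =i [:: e1; e2; e3; e4].
  have := mem_enum F; have := enum_uniq F; move: F4; rewrite cardE.
  case: (enum F) => [|e1 [|e2 [|e3 [|e4 [|]]]]] //= _ u m.
  by exists e1, e2, e3, e4; split=> // x; rewrite m.
have cE : cover F = e1 :|: e2 :|: e3 :|: e4.
  apply/setP=> x; apply/bigcupP/idP.
    by case=> e; rewrite mF !inE => /or4P[]/eqP-> ->; rewrite ?orbT.
  by rewrite !inE -!orbA => /or4P[] h;
     [exists e1 | exists e2 | exists e3 | exists e4]; rewrite // mF !inE eqxx ?orbT.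
have m1 : e1 \in edges by rewrite FE // mF !inE eqxx.
have m2 : e2 \in edges by rewrite FE // mF !inE eqxx orbT.
have m3 : e3 \in edges by rewrite FE // mF !inE eqxx !orbT.
have m4 : e4 \in edges by rewrite FE // mF !inE eqxx !orbT.
rewrite cE.
(* Any two of the four edges may form the diamond; the equation on predicates expresses that
   [a, b, c, d] rearranges the four edges. *)
have key a b c d : a \in edges -> b \in edges -> c \in edges -> d \in edges ->
    (forall p : pred {set V}, p a + (p b + (p c + p d)) = p e1 + (p e2 + (p e3 + p e4))) ->
    #|a :&: b| <= 1 \/ 6 < #|e1 :|: e2 :|: e3 :|: e4|.
  move=> ha hb hc hd p; have [h|] := ltnP 1 #|a :&: b|; [right|by left].
  have P : perm_eq [:: a; b; c; d] [:: e1; e2; e3; e4].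
    by apply/permP=> q /=; rewrite !addn0 p.
  have <- : a :|: b :|: c :|: d = e1 :|: e2 :|: e3 :|: e4.
    apply/setP=> x; have := perm_has (fun e : {set V} => x \in e) P.
    by rewrite /= !inE -!orbA !orbF.
  by apply: four_edges_diamond; rewrite ?(perm_uniq P).
have perm (a b c d : bool) : [/\ a + (c + (b + d)) = a + (b + (c + d)),
    a + (d + (b + c)) = a + (b + (c + d)), b + (c + (a + d)) = a + (b + (c + d)),
    b + (d + (a + c)) = a + (b + (c + d)) & c + (d + (a + b)) = a + (b + (c + d))].
  by case: a; case: b; case: c; case: d.
have P p := perm (p e1) (p e2) (p e3) (p e4).
have [i12|//] := key e1 e2 e3 e4 m1 m2 m3 m4 (fun=> erefl).
have [i13|//] := key e1 e3 e2 e4 m1 m3 m2 m4 (fun p => let: And5 h _ _ _ _ := P p in h).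
have [i14|//] := key e1 e4 e2 e3 m1 m4 m2 m3 (fun p => let: And5 _ h _ _ _ := P p in h).
have [i23|//] := key e2 e3 e1 e4 m2 m3 m1 m4 (fun p => let: And5 _ _ h _ _ := P p in h).
have [i24|//] := key e2 e4 e1 e3 m2 m4 m1 m3 (fun p => let: And5 _ _ _ h _ := P p in h).
have [i34|//] := key e3 e4 e1 e2 m3 m4 m1 m2 (fun p => let: And5 _ _ _ _ h := P p in h).
exact: four_edges_linear.
Qed.
End SystemFree.

Lemma system_comp (V W I : Type) (phi : I -> nat -> V) (g : V -> W) :
  injective g -> system phi -> system (fun t i => g (phi t i)).
Proof.
move=> gi [h1 h2 h3 h4]; split.
- by move=> t i k hi hk /gi; apply: h1.
- by move=> t t' i k i' k' c c' /gi e1 /gi e2; apply: h2 e1 e2.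
- by move=> t t' i k i' k' c c' /gi e1 /gi e2; apply: h3 e1 e2.
have T x y z : triple_of (fun t i => g (phi t i)) x y z ->
    exists x' y' z', [/\ triple_of phi x' y' z', x = g x', y = g y' & z = g z'].
  case=> t [i [k [l [h ex ey ez]]]]; exists (phi t i), (phi t k), (phi t l).
  by split=> //; exists t, i, k, l.
move=> x12 x13 x14 x23 x24 x34 /T[y12 [y13 [y14 [t1 -> -> ->]]]].
case/T=> [z12 [y23 [y24 [t2 /gi e12 -> ->]]]] /T[z13 [z23 [y34 [t3 /gi e13 /gi e23 ->]]]].
case/T=> [z14 [z24 [z34 [t4 /gi e14 /gi e24 /gi e34]]]] n1 n2 n3.
rewrite -{}e12 in t2; rewrite -{}e13 -{}e23 in t3; rewrite -{}e14 -{}e24 -{}e34 in t4.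
apply: (h4 _ _ _ _ _ _ t1 t2 t3 t4) => e; [apply: n1|apply: n2|apply: n3]; exact: congr1.
Qed.

Lemma fmax_system (V I : finType) (phi : I -> nat -> V) n :
  system phi -> #|V| <= n -> 7 * #|I| <= fmax 3 n 6 4.
Proof.
move=> S Vn; pose g (x : V) : 'I_n := widen_ord Vn (enum_rank x).
have gi : injective g.
  by move=> x y /(congr1 val)/= h; apply: enum_rank_inj; apply: val_inj.
have S' := system_comp gi S.
rewrite -(card_edges S') /fmax.
apply: (@leq_bigmax_cond _ _ (fun E : {set {set 'I_n}} => #|E|)).
by rewrite system_rgraph // system_sk_free.
Qed.

(** * Blowing up a cyclic decomposition of the complete graph on 37 vertices *)

Import Order.TTheory GRing.Theory Num.Theory.
Local Open Scope ring_scope.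

(* Found by computer search: the 36 ordered claimed pairs have distinct differences
   modulo 37, and the translates of the seven triples contain no Pasch configuration
   except for degenerate ones, which [slope1] and [slope2] take care of. *)
Definition row_of (i : nat) : 'Z_37 := inZp (nth 0%N [:: 0; 3; 21; 14; 5; 25; 15; 8; 1]%N i).
Definition slope1 (i : nat) : int := nth 0 [:: 0; 1; 3; 3; 2; 0; 2; 1; 2] i.
Definition slope2 (i : nat) : int := nth 0 [:: 0; 1; 3; 2; 3; 2; 0; 2; 1] i.

(** The bound 12 makes a small integer a divisor of 12 factorial, hence invertible modulo any [m]
    that is 1 modulo 12 factorial. *)
Definition small (z : int) : bool := (z != 0) && (`|z| <= 12)%N.

(* Four lines in general position whose meeting points have the abscissae [c_jk] exist
   only if this determinant vanishes. *)
Definition menelaus (R : comNzRingType) (c12 c13 c14 c23 c24 c34 : R) : R :=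
  (c14 - c12) * (c34 - c13) * (c24 - c23) - (c14 - c13) * (c34 - c23) * (c24 - c12).

Lemma row_inj i k : (i < 9)%N -> (k < 9)%N -> row_of i = row_of k -> i = k.
Proof.
move=> hi hk; have /allP/(_ i) : all (fun i => all (fun k => (row_of i == row_of k) ==> (i == k))
  (iota 0 9)) (iota 0 9) by vm_compute.
rewrite mem_iota hi => /(_ isT)/allP/(_ k); rewrite mem_iota hk => /(_ isT)/implyP h /eqP.
by move/h/eqP.
Qed.

Lemma claimed_diff i k i' k' : claimed i k -> claimed i' k' ->
  row_of i - row_of k = row_of i' - row_of k' -> i = i' /\ k = k'.
Proof.
rewrite /claimed => h h'; have /allP/(_ _ h)/allP/(_ _ h') :
  all (fun p => all (fun q =>
    if row_of p.1 - row_of p.2 == row_of q.1 - row_of q.2 then p == q else true)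
    [seq (t.1.1, t.1.2) | t <- otriples]) [seq (t.1.1, t.1.2) | t <- otriples].
  by vm_compute.
by move=> /= hh e; move: hh; rewrite e eqxx => /eqP[].
Qed.

Lemma claimed_facts i k : claimed i k -> [&& (i < 9)%N, (k < 9)%N, i != k,
  small (slope1 i - slope1 k) & small (slope2 i - slope2 k)].
Proof.
case/claimed_triple=> l; move: i k l; apply: triple_all; by vm_compute.
Qed.

Lemma reserved_facts i k : reserved_pair i k -> [&& (i < 9)%N, (k < 9)%N, i != k &
  (slope1 i == slope1 k) || (slope2 i == slope2 k)].
Proof.
rewrite /reserved_pair => /orP[] h.
  by have /allP/(_ _ h) : all (fun p => [&& (p.1 < 9)%N, (p.2 < 9)%N, p.1 != p.2 &
    (slope1 p.1 == slope1 p.2) || (slope2 p.1 == slope2 p.2)]) reserved by vm_compute.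
by have /allP/(_ _ h) : all (fun p => [&& (p.2 < 9)%N, (p.1 < 9)%N, p.2 != p.1 &
    (slope1 p.2 == slope1 p.1) || (slope2 p.2 == slope2 p.1)]) reserved by vm_compute.
Qed.

(* Line [j] carries the triple [tj]; two lines meet in the positions paired up here. *)
Definition pasch_ok (t1 t2 t3 t4 : nat * nat * nat) : bool :=
  let x12 := t1.1.1 in let x13 := t1.1.2 in let x14 := t1.2 in
  let x23 := t2.1.2 in let x24 := t2.2 in let x34 := t3.2 in
  [&& (x12 == t2.1.1), (x13 == t3.1.1), (x14 == t4.1.1), (x23 == t3.1.2), (x24 == t4.1.2) &
    (x34 == t4.2)] &&
  [&& small (menelaus (slope1 x12) (slope1 x13) (slope1 x14)
                      (slope1 x23) (slope1 x24) (slope1 x34)),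
      small (menelaus (slope2 x12) (slope2 x13) (slope2 x14)
                      (slope2 x23) (slope2 x24) (slope2 x34))
    & [|| x12 == x34, x13 == x24 | x14 == x23]].

Definition pasch_check : bool :=
  all (fun t1 => all (fun t2 => all (fun t3 =>
    if row_of t1.1.1 - row_of t2.1.1 + row_of t2.1.2 ==
       row_of t1.1.2 - row_of t3.1.1 + row_of t3.1.2 then
    all (fun t4 =>
    if row_of t1.1.1 - row_of t2.1.1 + row_of t2.2 ==
       row_of t1.2 - row_of t4.1.1 + row_of t4.1.2 then
    if row_of t1.1.2 - row_of t3.1.1 + row_of t3.2 == row_of t1.2 - row_of t4.1.1 + row_of t4.2 then
    pasch_ok t1 t2 t3 t4 else true else true) otriples else true) otriples) otriples) otriples.

Lemma pasch_checked : pasch_check.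
Proof. by vm_compute. Qed.

(** No three translates have the form [abc], [abd], [acd]. Such a triple of translates would arise
    from a Pasch configuration with one line inside a row, since that line collapses to the point
    [a]. *)
Definition pyramid_check : bool :=
  all (fun t2 => all (fun t3 =>
    if row_of t2.1.2 - row_of t2.1.1 == row_of t3.1.2 - row_of t3.1.1 then
    all (fun t4 =>
    if row_of t2.2 - row_of t2.1.1 == row_of t4.1.2 - row_of t4.1.1 then
    row_of t3.2 - row_of t3.1.1 != row_of t4.2 - row_of t4.1.1 else true) otriples else true)
    otriples) otriples.

Lemma pyramid_checked : pyramid_check.
Proof. by vm_compute. Qed.

Lemma translate_sub (V : zmodType) (j j' a a' b b' : V) :
  j + a = j' + a' -> j + b = j' + b' -> a - b = a' - b'.
Proof.
have e (x y z : V) : y - z = x + y - (x + z) by rewrite opprD addrACA subrr add0r.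
by move=> ea eb; rewrite (e j) ea eb -e.
Qed.

Lemma row_pyramid (j2 j3 j4 : 'Z_37) i2 k2 l2 i3 k3 l3 i4 k4 l4 :
  triple i2 k2 l2 -> triple i3 k3 l3 -> triple i4 k4 l4 ->
  j2 + row_of i2 = j3 + row_of i3 -> j2 + row_of i2 = j4 + row_of i4 ->
  j2 + row_of k2 = j3 + row_of k3 -> j2 + row_of l2 = j4 + row_of k4 ->
  j3 + row_of l3 = j4 + row_of l4 -> False.
Proof.
move=> h2 h3 h4 e1 e2 e3 e4 e5.
have /allP/(_ _ h2)/allP/(_ _ h3) := pyramid_checked.
have -> : row_of (i2, k2, l2).1.2 - row_of (i2, k2, l2).1.1 == row_of k3 - row_of i3.
  by apply/eqP; apply: translate_sub e3 e1.
move=> /allP/(_ _ h4).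
have -> : row_of (i2, k2, l2).2 - row_of (i2, k2, l2).1.1 == row_of k4 - row_of i4.
  by apply/eqP; apply: translate_sub e4 e2.
by move=> /eqP; apply; apply: translate_sub e5 _; rewrite -e1.
Qed.

Lemma row_pasch (j1 j2 j3 j4 : 'Z_37) (t1 t2 t3 t4 : nat * nat * nat) :
  t1 \in otriples -> t2 \in otriples -> t3 \in otriples -> t4 \in otriples ->
  j1 + row_of t1.1.1 = j2 + row_of t2.1.1 -> j1 + row_of t1.1.2 = j3 + row_of t3.1.1 ->
  j1 + row_of t1.2 = j4 + row_of t4.1.1 -> j2 + row_of t2.1.2 = j3 + row_of t3.1.2 ->
  j2 + row_of t2.2 = j4 + row_of t4.1.2 -> j3 + row_of t3.2 = j4 + row_of t4.2 ->
  pasch_ok t1 t2 t3 t4.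
Proof.
move=> h1 h2 h3 h4 e12 e13 e14 e23 e24 e34.
have d j r r' : j1 + r = j + r' -> r - r' = j - j1.
  by move=> e; rewrite -[r](addKr j1) e addrA addrK addrC.
have /allP/(_ _ h1)/allP/(_ _ h2)/allP/(_ _ h3) := pasch_checked.
rewrite (d _ _ _ e12) (d _ _ _ e13).
have -> : j2 - j1 + row_of t2.1.2 == j3 - j1 + row_of t3.1.2.
  by rewrite addrAC e23 addrAC.
move=> /allP/(_ _ h4); rewrite (d _ _ _ e14).
have -> : j2 - j1 + row_of t2.2 == j4 - j1 + row_of t4.1.2 by rewrite addrAC e24 addrAC.
by have -> : j3 - j1 + row_of t3.2 == j4 - j1 + row_of t4.2 by rewrite addrAC e34 addrAC.
Qed.

Lemma menelaus_concurrent (A : comNzRingType)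
    (c12 c13 c14 c23 c24 c34 a1 a2 a3 a4 b1 b2 b3 b4 : A) :
  a1 + c12 * b1 = a2 + c12 * b2 -> a1 + c13 * b1 = a3 + c13 * b3 ->
  a1 + c14 * b1 = a4 + c14 * b4 -> a2 + c23 * b2 = a3 + c23 * b3 ->
  a2 + c24 * b2 = a4 + c24 * b4 -> a3 + c34 * b3 = a4 + c34 * b4 ->
  [/\ menelaus c12 c13 c14 c23 c24 c34 * (b1 - b4) = 0,
      (c12 - c14) * (b1 - b4) = (c12 - c24) * (b2 - b4) &
      (c13 - c14) * (b1 - b4) = (c13 - c34) * (b3 - b4)].
Proof.
move=> /eqP; rewrite -subr_eq0 => /eqP e12 /eqP; rewrite -subr_eq0 => /eqP e13.
move=> /eqP; rewrite -subr_eq0 => /eqP e14 /eqP; rewrite -subr_eq0 => /eqP e23.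
move=> /eqP; rewrite -subr_eq0 => /eqP e24 /eqP; rewrite -subr_eq0 => /eqP e34.
have h1 : (c12 - c14) * (b1 - b4) = (c12 - c24) * (b2 - b4).
  apply/eqP; rewrite -subr_eq0; apply/eqP.
  transitivity ((a1 + c12 * b1 - (a2 + c12 * b2)) - (a1 + c14 * b1 - (a4 + c14 * b4))
    + (a2 + c24 * b2 - (a4 + c24 * b4))); first by ring.
  by rewrite e12 e14 e24; ring.
have h2 : (c13 - c14) * (b1 - b4) = (c13 - c34) * (b3 - b4).
  apply/eqP; rewrite -subr_eq0; apply/eqP.
  transitivity ((a1 + c13 * b1 - (a3 + c13 * b3)) - (a1 + c14 * b1 - (a4 + c14 * b4))
    + (a3 + c34 * b3 - (a4 + c34 * b4))); first by ring.
  by rewrite e13 e14 e34; ring.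
have h3 : (c23 - c24) * (b2 - b4) = (c23 - c34) * (b3 - b4).
  apply/eqP; rewrite -subr_eq0; apply/eqP.
  transitivity ((a2 + c23 * b2 - (a3 + c23 * b3)) - (a2 + c24 * b2 - (a4 + c24 * b4))
    + (a3 + c34 * b3 - (a4 + c34 * b4))); first by ring.
  by rewrite e23 e24 e34; ring.
split=> //; rewrite /menelaus.
transitivity ((c34 - c13) * (c23 - c24) * ((c12 - c14) * (b1 - b4))
  - (c34 - c23) * (c12 - c24) * ((c13 - c14) * (b1 - b4))); first by ring.
rewrite h1 h2.
transitivity ((c34 - c13) * (c12 - c24) *
  ((c23 - c24) * (b2 - b4) - (c23 - c34) * (b3 - b4))); first by ring.
by rewrite h3; ring.
Qed.

Lemma pair_ext (T U W : Type) (p q : T * (U * W)) :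
  p.1 = q.1 -> p.2.1 = q.2.1 -> p.2.2 = q.2.2 -> p = q.
Proof. by case: p q => [a [b c]] [a' [b' c']] /= -> -> ->. Qed.

(** * The blow-up of a system, over a ring where small integers are regular *)

Section BlowUp.
Variable A : comNzRingType.
Hypothesis regA : forall (z : int) (x : A), small z -> z%:~R * x = 0 -> x = 0.
Variables (I0 : Type) (phi0 : I0 -> nat -> A * A).
Hypothesis S0 : system phi0.

(* A nonzero direction separates claimed pairs in both coordinates, so that they cannot
   be reserved. *)
Definition punctured : Type := {b : A | b != 0}.
Definition line : Type := (A * punctured)%type.

Definition at_slope (l : line) (c : int) : A := l.1 + c%:~R * sval l.2.

Definition cross (p : 'Z_37 * (line * line)) (i : nat) : 'Z_37 * (A * A) :=
  (p.1 + row_of i, (at_slope p.2.1 (slope1 i), at_slope p.2.2 (slope2 i))).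

(** The left summand consists of copies with all vertices in different rows, one row per vertex of
    the base; the right one repeats the given system inside every row. *)
Definition blow_up (x : 'Z_37 * (line * line) + 'Z_37 * I0) (i : nat) : 'Z_37 * (A * A) :=
  match x with inl p => cross p i | inr (r, t) => (r, phi0 t i) end.

Lemma line_ext (l l' : line) : l.1 = l'.1 -> sval l.2 = sval l'.2 -> l = l'.
Proof. by case: l l' => [a b] [a' b'] /= -> /val_inj->. Qed.

Lemma line_eq (l l' : line) c c' : small (c - c') ->
  at_slope l c = at_slope l' c -> at_slope l c' = at_slope l' c' -> l = l'.
Proof.
rewrite /at_slope => s e e'.
have eb : sval l.2 = sval l'.2.
  apply/eqP; rewrite -subr_eq0; apply/eqP; apply: regA s _.
  rewrite rmorphB /=.
  transitivity ((l.1 + c%:~R * sval l.2 - (l.1 + c'%:~R * sval l.2))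
    - (l'.1 + c%:~R * sval l'.2 - (l'.1 + c'%:~R * sval l'.2))); first by ring.
  by rewrite e e' subrr.
by apply: line_ext => //; move: e; rewrite eb => /addIr.
Qed.

Lemma at_slope_neq (l : line) c c' : small (c - c') -> at_slope l c <> at_slope l c'.
Proof.
move=> s /eqP; rewrite -subr_eq0 => /eqP e; move: (valP l.2) => /eqP; apply.
apply: (regA s); rewrite -[RHS]e /at_slope rmorphB /=. by ring.
Qed.

Lemma four_lines (l1 l2 l3 l4 : line) (c12 c13 c14 c23 c24 c34 : int) :
  small (menelaus c12 c13 c14 c23 c24 c34) -> small (c12 - c24) -> small (c13 - c34) ->
  at_slope l1 c12 = at_slope l2 c12 -> at_slope l1 c13 = at_slope l3 c13 ->
  at_slope l1 c14 = at_slope l4 c14 -> at_slope l2 c23 = at_slope l3 c23 ->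
  at_slope l2 c24 = at_slope l4 c24 -> at_slope l3 c34 = at_slope l4 c34 ->
  [/\ l1 = l4, l2 = l4 & l3 = l4].
Proof.
rewrite /at_slope => sP s12 s13 e12 e13 e14 e23 e24 e34.
have [hP h12 h13] := menelaus_concurrent e12 e13 e14 e23 e24 e34.
have b14 : sval l1.2 - sval l4.2 = 0.
  by apply: (regA sP); apply: etrans hP; rewrite /menelaus !(rmorphB, rmorphM).
have b24 : sval l2.2 - sval l4.2 = 0.
  by apply: (regA s12); rewrite rmorphB /= -h12 b14 mulr0.
have b34 : sval l3.2 - sval l4.2 = 0.
  by apply: (regA s13); rewrite rmorphB /= -h13 b14 mulr0.
move/eqP: b14; rewrite subr_eq0 => /eqP b14; move/eqP: b24; rewrite subr_eq0 => /eqP b24.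
move/eqP: b34; rewrite subr_eq0 => /eqP b34.
split; apply: line_ext => //; [move: e14 | move: e24 | move: e34];
  by rewrite ?b14 ?b24 ?b34 => /addIr.
Qed.

Lemma cross_eq p p' i i' : cross p i = cross p' i' ->
  [/\ p.1 + row_of i = p'.1 + row_of i', at_slope p.2.1 (slope1 i) = at_slope p'.2.1 (slope1 i') &
  at_slope p.2.2 (slope2 i) = at_slope p'.2.2 (slope2 i')].
Proof.
move=> e; split; first exact: (congr1 fst e).
  exact: (congr1 (fun z => z.2.1) e).
exact: (congr1 (fun z => z.2.2) e).
Qed.

Lemma cross_claim p p' i k i' k' : claimed i k -> claimed i' k' ->
  cross p i = cross p' i' -> cross p k = cross p' k' -> p = p'.
Proof.
move=> h h' /cross_eq[r1 x1 y1] /cross_eq[r2 x2 y2].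
have [ei ek] := claimed_diff h h' (translate_sub r1 r2).
rewrite -{}ei -{}ek in r1 r2 x1 x2 y1 y2.
have /and5P[_ _ _ s1 s2] := claimed_facts h.
have e1 := line_eq s1 x1 x2; have e2 := line_eq s2 y1 y2.
by apply: pair_ext => //; apply: addIr r1.
Qed.

Lemma cross_rows p i k : (i < 9)%N -> (k < 9)%N -> i != k -> (cross p i).1 <> (cross p k).1.
Proof. by move=> hi hk ik /addrI /(row_inj hi hk) e; rewrite e eqxx in ik. Qed.

(** By the finite check the rows match only if the positions match too, with small determinants in
    both coordinates. Then all four lines belong to one copy, and the coincidence of positions in
    [pasch_ok] becomes one of vertices. *)
Lemma cross_pasch p1 p2 p3 p4 (t1 t2 t3 t4 : nat * nat * nat) :
  t1 \in otriples -> t2 \in otriples -> t3 \in otriples -> t4 \in otriples ->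
  cross p1 t1.1.1 = cross p2 t2.1.1 -> cross p1 t1.1.2 = cross p3 t3.1.1 ->
  cross p1 t1.2 = cross p4 t4.1.1 -> cross p2 t2.1.2 = cross p3 t3.1.2 ->
  cross p2 t2.2 = cross p4 t4.1.2 -> cross p3 t3.2 = cross p4 t4.2 ->
  [\/ cross p1 t1.1.1 = cross p3 t3.2, cross p1 t1.1.2 = cross p2 t2.2 |
      cross p1 t1.2 = cross p2 t2.1.2].
Proof.
move=> h1 h2 h3 h4 /cross_eq[r12 x12 y12] /cross_eq[r13 x13 y13] /cross_eq[r14 x14 y14].
move=> /cross_eq[r23 x23 y23] /cross_eq[r24 x24 y24] /cross_eq[r34 x34 y34].
have := row_pasch h1 h2 h3 h4 r12 r13 r14 r23 r24 r34.
move: t1 t2 t3 t4 h1 h2 h3 h4 r12 r13 r14 r23 r24 r34 x12 x13 x14 x23 x24 x34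
  y12 y13 y14 y23 y24 y34 => [[i1 k1] m1] [[i2 k2] m2] [[i3 k3] m3] [[i4 k4] m4] /=.
move=> h1 h2 h3 h4 r12 r13 r14 r23 r24 r34 x12 x13 x14 x23 x24 x34 y12 y13 y14 y23 y24 y34.
rewrite /pasch_ok /= => /andP[/and5P[/eqP E1 /eqP E2 /eqP E3 /eqP E4 /andP[/eqP E5 /eqP E6]]].
case/and3P=> sP1 sP2 coinc; subst i2 i3 i4 k3 k4 m4.
have c21 : claimed i1 m2 by have /and5P[_ _ _ _ /and5P[_ _ _ /triple_facts
  /and5P[_ _ _ _ /and5P[_ _ _ _ /andP[_ ?]]] _]] := triple_facts (h2 : triple i1 k2 m2).
have c31 : claimed k1 m3 by have /and5P[_ _ _ _ /and5P[_ _ _ /triple_facts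
  /and5P[_ _ _ _ /and5P[_ _ _ _ /andP[_ ?]]] _]] := triple_facts (h3 : triple k1 k2 m3).
have /and5P[_ _ _ s21 s21'] := claimed_facts c21; have /and5P[_ _ _ s31 s31'] := claimed_facts c31.
have [xa xb xc] := four_lines sP1 s21 s31 x12 x13 x14 x23 x24 x34.
have [ya yb yc] := four_lines sP2 s21' s31' y12 y13 y14 y23 y24 y34.
have e2 : p2 = p1.
  by apply: pair_ext; [apply: esym; apply: addIr r12|rewrite xa xb|rewrite ya yb].
have e3 : p3 = p1.
  by apply: pair_ext; [apply: esym; apply: addIr r13|rewrite xa xc|rewrite ya yc].
rewrite e2 e3; case/or3P: coinc => /eqP->; [exact: Or31 | exact: Or32 | exact: Or33].
Qed.

Definition in_row (x y z : 'Z_37 * (A * A)) : Prop :=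
  [/\ x.1 = y.1, x.1 = z.1 & triple_of phi0 x.2 y.2 z.2].

Lemma blow_up_triple x y z : triple_of blow_up x y z -> triple_of cross x y z \/ in_row x y z.
Proof.
case=> -[p|[r t]] [i [k [l [h -> -> ->]]]]; [left|right].
  by exists p, i, k, l.
by split=> //; exists t, i, k, l.
Qed.

Lemma triple_swap12 (V I : Type) (phi : I -> nat -> V) x y z :
  triple_of phi x y z -> triple_of phi y x z.
Proof.
case=> t [i [k [l [h -> -> ->]]]]; exists t, k, i, l; split=> //.
by have /and5P[_ _ _ _ /and5P[_ _ ? _ _]] := triple_facts h.
Qed.

Lemma triple_swap23 (V I : Type) (phi : I -> nat -> V) x y z :
  triple_of phi x y z -> triple_of phi x z y.
Proof.
case=> t [i [k [l [h -> -> ->]]]]; exists t, i, l, k; split=> //.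
by have /and5P[_ _ _ _ /and5P[_ _ _ ? _]] := triple_facts h.
Qed.

Lemma cross_triple_rows x y z : triple_of cross x y z ->
  [/\ x.1 <> y.1, x.1 <> z.1 & y.1 <> z.1].
Proof.
case=> p [i [k [l [h -> -> ->]]]].
have /and5P[hi hk hl ik /and5P[kl il _ _ _]] := triple_facts h.
by split; apply: cross_rows.
Qed.

Lemma row_apex_pasch x12 x13 x14 x23 x24 x34 :
  in_row x12 x13 x14 -> triple_of blow_up x12 x23 x24 ->
  triple_of blow_up x13 x23 x34 -> triple_of blow_up x14 x24 x34 ->
  x12 <> x34 -> x13 <> x24 -> x14 <> x23 -> False.
Proof.
move=> [r13 r14 t1] /blow_up_triple[t2|[r23 r24 t2]].
  have [n1 n2 n3] := cross_triple_rows t2.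
  move=> /blow_up_triple[t3|[r23 _ _]]; last by case: n1; rewrite r13.
  move=> /blow_up_triple[t4|[r24 _ _]]; last by case: n2; rewrite r14.
  move: t2 t3 t4 => [p2 [i2 [k2 [l2 [h2 e12 e23 e24]]]]].
  move=> [p3 [i3 [k3 [l3 [h3 e13 e23' e34]]]]] [p4 [i4 [k4 [l4 [h4 e14 e24' e34']]]]] _ _ _.
  apply: (row_pyramid (j2 := p2.1) (j3 := p3.1) (j4 := p4.1) h2 h3 h4).
  - by rewrite e12 e13 in r13; exact: r13.
  - by rewrite e12 e14 in r14; exact: r14.
  - by rewrite e23 in e23'; case: (cross_eq e23').
  - by rewrite e24 in e24'; case: (cross_eq e24').
  - by rewrite e34 in e34'; case: (cross_eq e34').
move=> /blow_up_triple[/cross_triple_rows[n _ _]|[_ r34 t3]].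
  by case: n; rewrite -r13 r23.
move=> /blow_up_triple[/cross_triple_rows[n _ _]|[_ _ t4]].
  by case: n; rewrite -r14 r24.
move=> n1 n2 n3; apply: (sys_pasch S0 t1 t2 t3 t4) => e.
- by apply: n1; rewrite (surjective_pairing x12) (surjective_pairing x34) e r13 r34.
- by apply: n2; rewrite (surjective_pairing x13) (surjective_pairing x24) e -r13 r24.
- by apply: n3; rewrite (surjective_pairing x14) (surjective_pairing x23) e -r14 r23.
Qed.

Lemma blow_up_system : system blow_up.
Proof.
split.
- move=> [p|[r t]] i k hi hk /=; last by case=> /(sys_inj S0); apply.
  by have [//|ik /(congr1 fst)/cross_rows[]] := eqVneq i k.
- move=> [p|[r t]] [p'|[r' t']] i k i' k' c c' /=.
  + by move=> e1 e2; rewrite (cross_claim c c' e1 e2).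
  (* A pair of a copy across rows lies in two rows, a pair of an inner copy in one. *)
  + have /and5P[hi hk ik _ _] := claimed_facts c.
    by move=> e1 e2; case: (@cross_rows p _ _ hi hk ik); rewrite e1 e2.
  + have /and5P[hi hk ik _ _] := claimed_facts c'.
    by move=> e1 e2; case: (@cross_rows p' _ _ hi hk ik); rewrite -e1 -e2.
  + by case=> <- e1 [e2]; rewrite (sys_claim S0 c c' e1 e2).
- move=> [p|[r t]] [p'|[r' t']] i k i' k' c c' /=.
  + have /and5P[_ _ _ s1 s2] := claimed_facts c; have /and4P[_ _ _ s] := reserved_facts c'.
    move=> /cross_eq[_ x1 y1] /cross_eq[_ x2 y2]; case/orP: s => /eqP s.
      by apply: (at_slope_neq (l := p.2.1) s1); rewrite x1 x2 s.
    by apply: (at_slope_neq (l := p.2.2) s2); rewrite y1 y2 s.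
  + have /and5P[hi hk ik _ _] := claimed_facts c.
    by move=> e1 e2; case: (@cross_rows p _ _ hi hk ik); rewrite e1 e2.
  + have /and4P[hi hk ik _] := reserved_facts c'.
    by move=> e1 e2; case: (@cross_rows p' _ _ hi hk ik); rewrite -e1 -e2.
  + by case=> _ e1 [_ e2]; apply: (sys_reserved S0 c c' e1 e2).
move=> x12 x13 x14 x23 x24 x34 t1 t2 t3 t4 n1 n2 n3.
have s2 := triple_swap12; have s3 := triple_swap23.
case/blow_up_triple: (t1) => [c1|r1]; last exact: row_apex_pasch r1 t2 t3 t4 n1 n2 n3.
case/blow_up_triple: (t2) => [c2|r2].
  case/blow_up_triple: (t3) => [c3|r3].
    case/blow_up_triple: (t4) => [c4|r4].
      move: c1 c2 c3 c4 => [p1 [i1 [k1 [m1 [h1 e12 e13 e14]]]]]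
        [p2 [i2 [k2 [m2 [h2 f12 e23 e24]]]]] [p3 [i3 [k3 [m3 [h3 f13 f23 e34]]]]]
        [p4 [i4 [k4 [m4 [h4 f14 f24 f34]]]]].
      have := @cross_pasch p1 p2 p3 p4 (i1, k1, m1) (i2, k2, m2) (i3, k3, m3) (i4, k4, m4)
        h1 h2 h3 h4; rewrite /= -e12 -e13 -e14 -e23 -e24 -e34.
      by case.
    by apply: (row_apex_pasch r4 (s2 _ _ _ _ _ _ (s3 _ _ _ _ _ _ t1))
      (s2 _ _ _ _ _ _ (s3 _ _ _ _ _ _ t2)) (s2 _ _ _ _ _ _ (s3 _ _ _ _ _ _ t3))) => // e;
      [apply: n2 | apply: n1].
  by apply: (row_apex_pasch r3 (s2 _ _ _ _ _ _ t1) (s2 _ _ _ _ _ _ t2)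
    (s2 _ _ _ _ _ _ (s3 _ _ _ _ _ _ t4))) => // e; [apply: n3 | apply: n1].
by apply: (row_apex_pasch r2 t1 (s2 _ _ _ _ _ _ t3) (s2 _ _ _ _ _ _ t4)) => // e;
  [apply: n3 | apply: n2].
Qed.

End BlowUp.

(** * Passage to the limit *)

Lemma Zp_regular m k : (1 < m)%N -> m = (1 + 12`! * k)%N ->
  forall (z : int) (x : 'Z_m), small z -> z%:~R * x = 0 -> x = 0.
Proof.
move=> m1 em z x /andP[z0 z12] zx.
have u : `|z|%N%:R \is a @GRing.unit 'Z_m.
  rewrite unitZpE // em.
  have zd : (`|z| %| 12`! * k)%N.
    by apply: dvdn_mulr; apply: dvdn_fact; rewrite z12 andbT absz_gt0.
  by have [w ->] := dvdnP zd; rewrite coprime_sym /coprime addnC gcdnMDl gcdn1.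
apply: (mulrI u); rewrite mulr0.
move: zx {z12 z0}; case: (intP z) => [|n|n] //; rewrite ?abszN /=.
  by rewrite rmorphN /= mulNr => /eqP; rewrite oppr_eq0 => /eqP.
Qed.

Lemma injection_exists (V W : finType) : (#|V| <= #|W|)%N -> exists g : V -> W, injective g.
Proof.
move=> h; exists (fun x => enum_val (widen_ord h (enum_rank x))) => x y /enum_val_inj.
by move=> /(congr1 val) /= e; apply: enum_rank_inj; apply: val_inj.
Qed.

Lemma expn4_add_le a b : (0 < a -> 0 < b -> (a + b) ^ 4 <= a ^ 4 + 15 * b ^ 4 * a ^ 3)%N.
Proof.
move=> a0 b0.
have -> : ((a + b) ^ 4 = a ^ 4 + (4 * (a ^ 3 * b ^ 1) + 6 * (a ^ 2 * b ^ 2)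
   + 4 * (a ^ 1 * b ^ 3) + 1 * (a ^ 0 * b ^ 4)))%N by ring.
rewrite leq_add2l.
have h i j : (i <= 3 -> j <= 4 -> a ^ i * b ^ j <= a ^ 3 * b ^ 4)%N.
  by move=> hi hj; apply: leq_mul; apply: leq_pexp2l.
have := h 3 1 isT isT; have := h 2 2 isT isT; have := h 1 3 isT isT; have := h 0 4 isT isT.
rewrite -mulnA [(b ^ 4 * _)%N]mulnC.
move: (a ^ 3 * b ^ 4)%N (a ^ 3 * b ^ 1)%N (a ^ 2 * b ^ 2)%N (a ^ 1 * b ^ 3)%N (a ^ 0 * b ^ 4)%N.
by clear; lia.
Qed.

(** The size is measured by [q] with [q ^ 2] vertices because a vertex is blown up to a square
    grid. *)
Definition packing (q N : nat) : Prop := exists (V I : finType) (phi : I -> nat -> V),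
  [/\ system phi, (#|V| <= q ^ 2)%N & (N <= #|I|)%N].

Lemma packing0 q : packing q 0.
Proof.
exists void, void, (fun t _ => t); split=> //; last by rewrite card_void.
Qed.

Lemma packing_step m k N q : (0 < k)%N -> m = (1 + 12`! * k)%N -> packing m N ->
  (37 * m ^ 2 <= q ^ 2)%N -> packing q (37 * (m * (m - 1)) ^ 2 + 37 * N).
Proof.
move=> k0 em [V [I [phi [S Vm NI]]]] mq.
have m1 : (1 < m)%N by rewrite em add1n ltnS muln_gt0 fact_gt0.
have cA : #|'Z_m| = m by rewrite card_ord Zp_cast.
have [g gi] : exists g : V -> 'Z_m * 'Z_m, injective g.
  by apply: injection_exists; rewrite card_prod cA mulnn.
have S' := blow_up_system (Zp_regular m1 em) (system_comp gi S).
exists ('Z_37 * ('Z_m * 'Z_m))%type, ('Z_37 * (line 'Z_m * line 'Z_m) + 'Z_37 * I)%type,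
  (blow_up (fun t i => g (phi t i))).
have cp : #|{: punctured 'Z_m}| = (m - 1)%N.
  by rewrite card_sig cardC1 cA subn1.
split=> //; first by rewrite !card_prod cA mulnn card_ord.
rewrite card_sum !card_prod card_ord cp cA mulnn.
by rewrite leq_add2l leq_pmul2l.
Qed.

(** * Densities of packings and bounds on [fmax] *)

Section Density.
Variable R : archiRealFieldType.

(** With [q ^ 2] vertices, [q ^ 4] is the square of their number, so [c] is an asymptotic lower
    density of copies. *)
Definition dense_packing (c : R) : Prop := exists2 C : R, 0 <= C & forall q : nat,
  exists2 N, packing q N & c * q%:R ^+ 4 - C * q%:R ^+ 3 <= N%:R.

Lemma dense_packing0 : dense_packing 0.
Proof.
exists 0 => // q; exists 0%N; first exact: packing0.
by rewrite !mul0r subrr.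
Qed.

(** The largest admissible [k] is taken; [k = 1] is admissible since [37 <= 7 ^ 2]. *)
Lemma side_exists M q : (0 < M)%N -> (7 * (1 + M) <= q)%N -> exists k,
  [/\ (0 < k)%N, (37 * (1 + M * k) ^ 2 <= q ^ 2)%N & (q ^ 2 <= 37 * (1 + M * k + M) ^ 2)%N].
Proof.
move=> M0 Mq; pose P k := (37 * (1 + M * k) ^ 2 <= q ^ 2)%N.
have P1 : P 1%N.
  rewrite /P muln1; apply: (@leq_trans ((7 * (1 + M)) ^ 2)); last by rewrite leq_sqr.
  by rewrite expnMn leq_pmul2r // expn_gt0.
have Pb k : P k -> (k <= q)%N.
  rewrite /P => h; rewrite -leq_sqr; apply: leq_trans h.
  apply: (@leq_trans ((1 + M * k) ^ 2)); last by rewrite leq_pmull.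
  by rewrite leq_sqr; apply: leq_trans (leq_addl _ _); rewrite leq_pmull.
case: (ex_maxnP (ex_intro P _ P1) Pb) => k Pk kmax; exists k; split=> //.
  exact: kmax.
rewrite leqNgt; apply/negP=> h; suff : (k < k)%N by rewrite ltnn.
by apply: kmax; rewrite /P mulnSr addnA ltnW.
Qed.

Lemma dense_packing_step c : 0 <= c -> dense_packing c -> dense_packing ((1 + c) / 37%:R).
Proof.
move=> c0 [C C0 cC].
(* [M] is 12 factorial, made opaque so that it is never computed. *)
have [M M0 step] : exists2 M, (0 < M)%N & forall m k N q, (0 < k)%N ->
    m = (1 + M * k)%N -> packing m N -> (37 * m ^ 2 <= q ^ 2)%N ->
    packing q (37 * (m * (m - 1)) ^ 2 + 37 * N).
  by exists 12`!; [rewrite fact_gt0 | exact: packing_step].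
(* The first term of [C1] pays for rounding [q] down to an admissible [m], the second for the
   excluded zero directions and for the error [C] of the inner packings; [C2] makes the claim
   trivial for small [q]. *)
pose C1 : R := 37%:R * (1 + c) * (15 * M ^ 4)%:R + 37%:R * (2%:R + C).
have C10 : 0 <= C1 by rewrite addr_ge0 ?mulr_ge0 ?addr_ge0.
pose C2 : R := (1 + c) / 37%:R * (7 * (1 + M))%:R.
have C20 : 0 <= C2 by rewrite !mulr_ge0 ?addr_ge0 ?invr_ge0.
exists (C1 + C2) => [|q]; first exact: addr_ge0.
have [qM|Mq] := ltnP q (7 * (1 + M)).
  exists 0%N; first exact: packing0.
  rewrite subr_le0 exprS mulrA ler_wpM2r ?exprn_ge0 //.
  rewrite (@le_trans _ _ C2) ?lerDr // /C2 ler_wpM2l ?ler_nat 1?ltnW //.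
  by rewrite mulr_ge0 ?addr_ge0 ?invr_ge0.
have [k [k0 mq qm]] := side_exists M0 Mq; set m := (1 + M * k)%N in mq qm.
have [N pN cN] := cC m.
exists (37 * (m * (m - 1)) ^ 2 + 37 * N)%N; first exact: step k0 _ pN mq.
have m0 : (0 < m)%N by [].
have q4 : q%:R ^+ 4 <= 37%:R ^+ 2 * (m%:R ^+ 4 + (15 * M ^ 4)%:R * m%:R ^+ 3) :> R.
  rewrite -!natrX -!natrM -natrD -natrM ler_nat.
  apply: (@leq_trans ((37 * (m + M) ^ 2) ^ 2)%N).
    by rewrite (expnM q 2 2) leq_sqr.
  by rewrite expnMn -expnM leq_pmul2l // expn4_add_le.
have mlq : (m <= q)%N.
  by rewrite -leq_sqr; apply: leq_trans mq; rewrite leq_pmull.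
have m3 : m%:R ^+ 3 <= q%:R ^+ 3 :> R by rewrite lerXn2r ?nnegrE ?ler_nat.
have mm : m%:R ^+ 4 - 2%:R * m%:R ^+ 3 <= ((m * (m - 1)) ^ 2)%:R :> R.
  rewrite natrX natrM natrB //.
  have -> : (m%:R * (m%:R - 1)) ^+ 2 = m%:R ^+ 4 - 2%:R * m%:R ^+ 3 + m%:R ^+ 2 :> R by ring.
  by rewrite lerDl exprn_ge0.
rewrite natrD ![(37 * _)%:R]natrM; move: q4 C10; rewrite /C1.
move: (m%:R : R) (q%:R : R) (N%:R : R) (((m * (m - 1)) ^ 2)%:R : R) ((15 * M ^ 4)%:R : R)
  cN m3 mm C20 (exprn_ge0 3 (ler0n R q)) => x y n p K cN m3 mm C20 y3 q4 C10.
set C1' := _ + _ in C10 *.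
have h1 : (1 + c) / 37%:R * y ^+ 4 <= 37%:R * (1 + c) * (x ^+ 4 + K * x ^+ 3).
  have -> : 37%:R * (1 + c) * (x ^+ 4 + K * x ^+ 3) =
    (1 + c) / 37%:R * (37%:R ^+ 2 * (x ^+ 4 + K * x ^+ 3)) by field.
  by rewrite ler_wpM2l // divr_ge0 // addr_ge0.
have h2 : C1' * x ^+ 3 <= (C1' + C2) * y ^+ 3.
  apply: (@le_trans _ _ (C1' * y ^+ 3)); first exact: ler_wpM2l.
  by rewrite ler_wpM2r // lerDl.
apply: le_trans (lerB h1 h2) _.
have -> : 37%:R * (1 + c) * (x ^+ 4 + K * x ^+ 3) - C1' * x ^+ 3 =
  37%:R * (x ^+ 4 - 2%:R * x ^+ 3) + 37%:R * (c * x ^+ 4 - C * x ^+ 3).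
  by rewrite /C1'; ring.
by apply: lerD; apply: ler_wpM2l.
Qed.

(** Each step divides the distance to the fixed point 1/36 by 37; the weaker rate [1 / k.+1]
    suffices. *)
Lemma dense_packing_approx k : exists c : R,
  [/\ 0 <= c, c <= 36%:R^-1, dense_packing c & (36%:R^-1 - c) * k.+1%:R <= 1].
Proof.
elim: k => [|k [c [c0 c1 dc ck]]].
  by exists 0; split; rewrite ?invr_ge0 //; [exact: dense_packing0 | lra].
exists ((1 + c) / 37%:R).
split; [by rewrite divr_ge0 ?addr_ge0 | lra | exact: dense_packing_step |].

have -> : 36%:R^-1 - (1 + c) / 37%:R = (36%:R^-1 - c) / 37%:R by lra.
apply: le_trans ck; rewrite -mulrA ler_wpM2l ?subr_ge0 //.
by rewrite mulrC ler_pdivrMr // -natrM ler_nat; lia.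
Qed.

Lemma fmax_lower (d : R) : 0 < d -> exists N, forall n, (N <= n)%N ->
  (7%:R / 36%:R - d) * n%:R ^+ 2 <= (fmax 3 n 6 4)%:R.
Proof.
move=> d0; have d14 : 0 <= 14%:R / d by rewrite divr_ge0 // ltW.
(* With 14/d, the defect [7 * (1/36 - c)] is at most [d / 2]; the other half of [d] absorbs the
   lower-order terms. *)
have [c [c0 c1 [C C0 dC] ck]] := dense_packing_approx (Num.bound (14%:R / d)).
have cd : 7%:R / 36%:R - d <= 7%:R * c - d / 2%:R.
  have : 14%:R / d <= (Num.bound (14%:R / d)).+1%:R.
    by apply: le_trans (ltW (archi_boundP d14)) _; rewrite ler_nat.
  rewrite ler_pdivrMr // => dK.
  suff : 14%:R * (36%:R^-1 - c) <= d by lra.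
  apply: le_trans (ler_wpM2r _ dK) _; first by rewrite subr_ge0.
  rewrite mulrAC -[X in _ <= X]mul1r ler_wpM2r ?(ltW d0) //.
  by rewrite mulrC.
have e0 : 0 <= 105%:R * c + 7%:R * C by rewrite addr_ge0 ?mulr_ge0.
have e1 : 0 <= (105%:R * c + 7%:R * C) / (d / 2%:R) by rewrite divr_ge0 // divr_ge0 // ltW.
(* The term [105 * c = 7 * 15 * c] comes from replacing [n] by the square [q ^ 2] below it, and
   [7 * C] from the packing error; both are of order [q ^ 3]. *)
set Q := (Num.bound ((105%:R * c + 7%:R * C) / (d / 2%:R))).+1.
exists (Q ^ 2)%N => n Qn.
have [q qn nq] : exists2 q, (q ^ 2 <= n)%N & (n < q.+1 ^ 2)%N.
  have P0 : exists q, (q ^ 2 <= n)%N by exists 0%N.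
  have Pb q : (q ^ 2 <= n)%N -> (q <= n)%N.
    by apply: leq_trans; case: q => // q; rewrite -mulnn leq_pmulr.
  case: (ex_maxnP P0 Pb) => q qn qmax; exists q => //.
  by rewrite ltnNge; apply/negP=> /qmax; rewrite ltnn.
have Qq : (Q <= q)%N by rewrite -ltnS -ltn_sqr; apply: leq_ltn_trans Qn nq.
have q0 : (0 < q)%N by apply: leq_trans Qq.
have [N [V [I [phi [S Vq NI]]]] cN] := dC q.
have fN : 7%:R * (c * q%:R ^+ 4 - C * q%:R ^+ 3) <= (fmax 3 n 6 4)%:R.
  apply: (@le_trans _ _ (7 * N)%:R); first by rewrite natrM ler_wpM2l.
  rewrite ler_nat; apply: leq_trans (fmax_system S (leq_trans Vq qn)).
  by rewrite leq_pmul2l.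
apply: (@le_trans _ _ ((7%:R * c - d / 2%:R) * n%:R ^+ 2)).
  by rewrite ler_wpM2r // exprn_ge0.
have [neg|pos] := leP (7%:R * c - d / 2%:R) 0.
  by apply: (@le_trans _ _ 0); rewrite // mulr_le0_ge0 // exprn_ge0.
apply: le_trans fN.
have n4 : n%:R ^+ 2 <= q%:R ^+ 4 + 15%:R * q%:R ^+ 3 :> R.
  rewrite -!natrX -natrM -natrD ler_nat.
  apply: (@leq_trans ((q + 1) ^ 4)%N); last by apply: leq_trans (expn4_add_le q0 _) _.
  by rewrite (expnM _ 2 2) leq_sqr addn1 ltnW.
apply: le_trans (ler_wpM2l (ltW pos) n4) _.
have dq : 105%:R * c + 7%:R * C <= d / 2%:R * q%:R.
  rewrite [_ / _ * _]mulrC -ler_pdivrMr ?divr_gt0 //; apply: le_trans (ltW (archi_boundP e1)) _.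
  by rewrite ler_nat; apply: leq_trans Qq.
have := ler_wpM2r (exprn_ge0 3 (ler0n R q)) dq.
have : 0 <= d / 2%:R * q%:R ^+ 3
  by apply: mulr_ge0; [apply: divr_ge0 => //; apply: ltW | apply: exprn_ge0].
rewrite -[_ * q%:R * _]mulrA -exprS.
move: (q%:R ^+ 3 : R) (q%:R ^+ 4 : R) => y3 y4 h1 h2; lra.
Qed.

Lemma fmax_upper n : (36 * fmax 3 n 6 4 <= 7 * n ^ 2 + 36 * n)%N.
Proof.
rewrite mulnC -leq_divRL //; apply/bigmax_leqP => E /andP[E3 Ef].
rewrite leq_divRL // mulnC; have := sk_free_upper_bound E3 Ef; rewrite card_ord.
have : ('C(n, 2) * 2 <= n ^ 2)%N.
  by rewrite (bin_ffact n 2) ffactnSr ffactn1 leq_mul // leq_subr.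
by move: #|E| 'C(n, 2) (n ^ 2)%N => e b s; clear; lia.
Qed.
End Density.

From mathcomp Require Import all_classical all_reals all_analysis.
Import numFieldNormedType.Exports.
Local Open Scope classical_set_scope.

Theorem theorem1p2 (R : realType) :
  (fun n : nat => (fmax 3 n 6 4)%:R / (n%:R : R) ^+ 2) @ \oo --> (7%:R / 36%:R : R).
Proof.
apply/cvgrPdist_le => e e0.
have [N hN] := fmax_lower e0.
have e1 : 0 <= e^-1 by rewrite invr_ge0 ltW.
(* [N] serves the lower bound; beyond 1/e the linear term of the upper bound is at most
   [e * n ^ 2]. *)
exists (N + Num.bound e^-1).+1 => // n /= hn.
have n0 : (0 < n)%N by apply: leq_trans hn.
have n0R : 0 < n%:R :> R by rewrite ltr0n.
have en : 1 <= e * n%:R.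
  rewrite -ler_pdivrMl // mulr1; apply: le_trans (ltW (archi_boundP e1)) _.
  by rewrite ler_nat; apply: leq_trans (ltnW hn); apply: leq_addl.
have lo := hN n (leq_trans (leq_addr _ _) (ltnW hn)).
have up : 36%:R * (fmax 3 n 6 4)%:R <= 7%:R * n%:R ^+ 2 + 36%:R * n%:R :> R.
  by rewrite -natrX -!natrM -natrD ler_nat fmax_upper.
rewrite distrC ler_norml; apply/andP; split.
  by rewrite lerBrDl ler_pdivlMr ?exprn_gt0.
rewrite lerBlDl ler_pdivrMr ?exprn_gt0 // -(ler_pM2l (_ : 0 < 36%:R :> R)) //.
apply: le_trans up _.
have -> : 36%:R * ((7%:R / 36%:R + e) * n%:R ^+ 2) =
  7%:R * n%:R ^+ 2 + 36%:R * (e * n%:R * n%:R) :> R by field.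
by rewrite lerD2l ler_wpM2l // ler_peMl.
Qed.
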